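(* Let $d\ge 2$ and $k\ge 2$ be integers, and let $\mathcal{M}_d\subseteq\mathbb{P}^d$ be the $d$th moment variety of either the inverse Gaussian distribution or the gamma distribution. Then $\mathcal{M}_d$ is $k$-nondefective, in the sense that $$\dim(\mathrm{Sec}_k(\mathcal{M}_d))=\min\{3k-1,\,d\}.$$ In particular, for every $k\geq 2$ we have algebraic identifiability from the first $3k-1$ moments for $k$-mixtures of the inverse Gaussian distribution and for $k$-mixtures of the gamma distribution; that is, for $d=3k-1$ the mixture moment map $\Phi_{k,d}$ (defined in the context) has finite fibers over generic points of $\mathrm{Sec}_k(\mathcal{M}_d)$.
   Context: All varieties are over $\mathbb{C}$. Moments. Inverse Gaussian distribution, with parameters $(\mu,\lambda)$, $\lambda\neq 0$: $m_0=1$, $m_1=\mu$, and $m_i=\frac{2i-3}{\lambda}\mu^2 m_{i-1}+\mu^2 m_{i-2}$ for $i\ge 2$. Gamma distribution, with parameters $(\kappa,\theta)$ (shape $\kappa$, scale $\theta$): $m_r=\theta^r\prod_{i=0}^{r-1}(i+\kappa)$ for $r\ge 0$ (so $m_0=1$). Moment variety. The $d$th moment variety $\mathcal{M}_d\subseteq\mathbb{P}^d$ of the distribution is the Zariski closure of the image of the rational map $\mathbb{C}^2\dashrightarrow\mathbb{P}^d$ sending the parameter pair to $[m_0:m_1:\cdots:m_d]$. It is an irreducible surface. Secant variety. For $X\subseteq\mathbb{P}^d$ irreducible, $\mathrm{Sec}_k(X)$ is the Zariski closure of the union of the linear spans of all $k$-tuples of points of $X$. One always has $\dim\mathrm{Sec}_k(X)\le\min\{k\dim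 X+k-1,d\}$, and $X$ is called $k$-nondefective if equality holds. Mixtures. The moment map of the $k$-mixture is the rational map $$\Phi_{k,d}\colon(\mathbb{C}^2)^k\times\{\alpha\in\mathbb{C}^k:\textstyle\sum_{i}\alpha_i=1\}\dashrightarrow\mathbb{P}^d,\quad (\theta^{(1)},\ldots,\theta^{(k)},\alpha)\mapsto\Big[\textstyle\sum_{i=1}^k\alpha_i m_r(\theta^{(i)})\Big]_{r=0,\ldots,d},$$ where $\theta^{(i)}\in\mathbb{C}^2$ denotes the parameter pair of the $i$th component, and its domain consists of the points where all moments are defined. The Zariski closure of its image is $\mathrm{Sec}_k(\mathcal{M}_d)$. Algebraic identifiability from the first $d$ moments means that the fibers of $\Phi_{k,d}$ over generic points of $\mathrm{Sec}_k(\mathcal{M}_d)$ are finite (equivalently, $\dim\mathrm{Sec}_k(\mathcal{M}_d)=3k-1$). *)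

(* Defs.v *)
From HB Require Import structures.
From mathcomp Require Import all_boot all_order all_algebra.
From mathcomp Require Import boolp classical_sets functions cardinality reals.
From mathcomp Require Import complex mpoly.

Set Implicit Arguments.
Unset Strict Implicit.
Unset Printing Implicit Defensive.

Import GRing.Theory.
Local Open Scope classical_set_scope.
Local Open Scope ring_scope.

Section ProjectiveGeometry.
Variable F : closedFieldType.

(* Points of P^d are the lines through the origin of F^(d+1). *)
Definition proj_space (d : nat) := {L : {vspace 'rV[F]_d.+1} | \dim L == 1%N}.

Section Fixed_dimension.
Variable d : nat.
Implicit Types (x : proj_space d) (S X Z U : set (proj_space d)).

(* x = [v_0 : ... : v_d]; since \val x is a line, this forces v <> 0. *)
Definition hcoords x (v : 'rV[F]_d.+1) := \val x = <[v]>%VS.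

Definition evalv (p : {mpoly F[d.+1]}) (v : 'rV[F]_d.+1) : F :=
  p.@[fun i => v 0 i].

(* Only used for homogeneous p, where it does not depend on the choice of the
   homogeneous coordinates v of x. *)
Definition vanishes_at (p : {mpoly F[d.+1]}) x :=
  forall v, hcoords x v -> evalv p v = 0.

Definition zariski_closure S : set (proj_space d) :=
  [set x | forall (e : nat) (p : {mpoly F[d.+1]}), p \is e.-homog ->
     (forall y, S y -> vanishes_at p y) -> vanishes_at p x].

Definition zariski_closed Z := zariski_closure Z = Z.

Definition zariski_irreducible X :=
  X !=set0 /\
  forall Z1 Z2, zariski_closed Z1 -> zariski_closed Z2 ->
    X `<=` Z1 `|` Z2 -> X `<=` Z1 \/ X `<=` Z2.

Definition relatively_open U X :=
  exists2 Z, zariski_closed Z & U = X `\` Z.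

(* The fraction f / g defines an element of the function field of the
   irreducible closed set Z. *)
Definition fraction_on Z (f g : {mpoly F[d.+1]}) :=
  [/\ exists e : nat, f \is e.-homog /\ g \is e.-homog
    & ~ (forall x, Z x -> vanishes_at g x)].

(* The elements f_i / g_i (i < n) of the function field of Z are algebraically
   independent over F: a rational function is zero in F(Z) iff it vanishes on
   the dense open subset of Z where all denominators are nonzero. *)
Definition alg_independent_on Z (n : nat) (f g : 'I_n -> {mpoly F[d.+1]}) :=
  forall P : {mpoly F[n]},
    (forall x v, Z x -> hcoords x v -> (forall i, evalv (g i) v != 0) ->
       P.@[fun i => evalv (f i) v / evalv (g i) v] = 0) ->
    P = 0.

(* The function field of Z has transcendence degree at least n over F. *)
Definition trdeg_ge Z (n : nat) :=
  exists f g : 'I_n -> {mpoly F[d.+1]},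
    (forall i, fraction_on Z (f i) (g i)) /\ alg_independent_on Z f g.

(* Dimension of a closed set X: the largest transcendence degree of the
   function field of an irreducible closed subset of X; for irreducible X this
   is the transcendence degree of F(X). *)
Definition has_dim X (n : nat) :=
  (exists Z, [/\ Z `<=` X, zariski_closed Z, zariski_irreducible Z
               & trdeg_ge Z n]) /\
  (forall Z m, Z `<=` X -> zariski_closed Z -> zariski_irreducible Z ->
     trdeg_ge Z m -> (m <= n)%N).

Definition linear_span (k : nat) (y : 'I_k -> proj_space d) :
    set (proj_space d) :=
  [set x | (\val x <= \sum_(i < k) \val (y i))%VS].

Definition Sec (k : nat) X : set (proj_space d) :=
  zariski_closure
    [set x | exists2 y : 'I_k -> proj_space d,
               (forall i, X (y i)) & linear_span y x].

End Fixed_dimension.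
End ProjectiveGeometry.

Section Moments.
Variable F : closedFieldType.

Inductive moment_family := InverseGaussian | Gamma.

Fixpoint inverse_gaussian_moment (mu lambda : F) (r : nat) : F :=
  match r with
  | 0 => 1
  | s.+1 =>
    match s with
    | 0 => mu
    | t.+1 =>
      ((2 * r)%:R - 3%:R) / lambda * mu ^+ 2 * inverse_gaussian_moment mu lambda s
      + mu ^+ 2 * inverse_gaussian_moment mu lambda t
    end
  end.

Definition gamma_moment (kappa theta : F) (r : nat) : F :=
  theta ^+ r * \prod_(i < r) (i%:R + kappa).

(* The parameter pair is (mu, lambda), resp. (kappa, theta). *)
Definition moment (D : moment_family) (t : F * F) (r : nat) : F :=
  match D with
  | InverseGaussian => inverse_gaussian_moment t.1 t.2 r
  | Gamma => gamma_moment t.1 t.2 r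
  end.

Definition param_domain (D : moment_family) (t : F * F) : Prop :=
  match D with
  | InverseGaussian => t.2 != 0
  | Gamma => True
  end.

Definition moment_vector (D : moment_family) (d : nat) (t : F * F) : 'rV[F]_d.+1 :=
  \row_(r < d.+1) moment D t r.

Definition moment_variety (D : moment_family) (d : nat) : set (proj_space F d) :=
  zariski_closure
    [set x | exists2 t : F * F,
               param_domain D t & hcoords x (moment_vector D d t)].

Definition mixture_params (k : nat) : Type :=
  ({ffun 'I_k -> F * F} * {ffun 'I_k -> F})%type.

Definition mixture_domain (D : moment_family) (k : nat) : set (mixture_params k) :=
  [set q : mixture_params k | (forall i, param_domain D (q.1 i)) /\ \sum_(i < k) q.2 i = 1].

Definition mixture_moment_vector (D : moment_family) (k d : nat)
    (q : mixture_params k) : 'rV[F]_d.+1 :=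
  \row_(r < d.+1) \sum_(i < k) q.2 i * moment D (q.1 i) r.

(* The fiber over x of the mixture moment map, whose value at q is the point
   with homogeneous coordinates mixture_moment_vector D d q. *)
Definition mixture_fiber (D : moment_family) (k d : nat) (x : proj_space F d) :
    set (mixture_params k) :=
  [set q : mixture_params k | mixture_domain D q /\ hcoords x (mixture_moment_vector D d q)].

(* Generic means on a dense relatively open subset of Sec_k(M_d). *)
Definition algebraically_identifiable (D : moment_family) (k d : nat) :=
  let X := Sec k (@moment_variety D d) in
  exists U : set (proj_space F d),
    [/\ relatively_open U X, X `<=` zariski_closure U
      & forall x, U x -> finite_set (@mixture_fiber D k d x)].

End Moments.

Arguments moment_variety F D d : clear implicits.
Arguments algebraically_identifiable F D k d : clear implicits.

(* Main.v *)
Require Import Defs.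
From mathcomp Require Import all_boot all_order all_algebra all_fingroup.
From mathcomp Require Import boolp classical_sets cardinality.
From mathcomp Require Import reals complex mpoly ring zify.

Set Implicit Arguments.
Unset Strict Implicit.
Unset Printing Implicit Defensive.

Import GRing.Theory.
Local Open Scope classical_set_scope.
Local Open Scope ring_scope.

(** Both families have moments of the form m_r = theta^r q_r(kappa) for explicit
    polynomials q_r with q_0 = 1: for the gamma distribution q_r is a rising
    factorial, and for the inverse Gaussian, with theta = mu and
    kappa = mu / lambda, it is a Bessel polynomial.  The secant variety is the
    closure of the set of points sum_i c_i m(t_i), so it is irreducible, and
    everything reduces to one fact: the mixture moments M_1, ..., M_(3k-1),
    as functions on the hyperplane sum_i c_i = 1 of the parameter space, are
    algebraically independent (mixture_moments_independent).

    By the Jacobian criterion in characteristic 0 (Terracini's lemma), this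
    holds once the 3k vectors m(t_i), dm/dkappa(t_i), theta dm/dtheta(t_i) in
    F^(3k) are linearly independent for some t_1, ..., t_k.  Such points are
    found one at a time (generic_points).  When the last theta tends to
    infinity, the three columns of highest index dominate its three rows, and
    the leading coefficient of the determinant in theta is the previous
    determinant times the 3 x 3 determinant W_r(kappa) with rows
    (q_j), (q_j'), (j q_j), j = r, r+1, r+2.  For the gamma family
    W_r = q_r^3 (kappa + r); for the inverse Gaussian family W_r(0) = -1.  So
    neither vanishes identically.

    Dimension: the ratios of coordinates x_j / x_0, j <= min(3k-1, d), are
    algebraically independent on the secant variety by the above.  Conversely,
    more than n fractions pulled back to a parametrization by n variables are
    algebraically dependent, by comparing the number of monomials of bounded
    exponents in the fractions with the dimension of a space of polynomials of
    bounded degree (algebraic_dependence, trdeg_ge_le).  This is applied to the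
    parametrization by the hyperplane sum_i c_i = 1, which has 3k-1 variables,
    and to the affine chart x_0 = 1 of the whole projective space.

    Fibers, for d = 3k-1: each parameter together with M_1, ..., M_d gives one
    function more than there are variables, hence satisfies a polynomial equation
    whose coefficients are polynomials in the moments, not all zero because the
    moments are independent.  Where these coefficients do not all vanish, the
    parameter takes finitely many values on the fiber. *)

(** * Determinants, polynomial curves and linear algebra *)

Lemma coef_prod_top (R : comNzRingType) (I : finType) (p : I -> {poly R})
    (d : I -> nat) :
  (forall i, size (p i) <= (d i).+1)%N ->
  (\prod_i p i)`_(\sum_i d i)%N = \prod_i (p i)`_(d i).
Proof.
move=> sp.
pose K (x : {poly R}) (n : nat) (a : R) := (size x <= n.+1)%N /\ x`_n = a.
suff [] : K (\prod_i p i) (\sum_i d i)%N (\prod_i (p i)`_(d i)) by [].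
apply: (big_ind3 K) => [|x1 n1 a1 x2 n2 a2|i _].
- by split; [rewrite size_poly1 | rewrite coefC].
- case=> s1 <- [s2 <-]; split.
    apply: (leq_trans (size_polyMleq _ _)).
    by rewrite -subn1 leq_subLR add1n -addSn -addnS leq_add.
  have i1 : (n1 < (n1 + n2).+1)%N by rewrite ltnS leq_addr.
  rewrite coefM (bigD1 (Ordinal i1)) //= addKn big1 ?addr0 // => -[j ltj].
  rewrite -(inj_eq val_inj) /=; case: ltngtP => // lj _.
    rewrite [x2`_ _]nth_default ?mulr0 //; apply: leq_trans s2 _.
    by rewrite ltn_subRL ltn_add2r.
  by rewrite [x1`_ _]nth_default ?mul0r //; apply: leq_trans s1 _.
- by split.
Qed.

(** In the Leibniz formula every permutation contributes in the same degree, the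
    sum of the column bounds, so top coefficients can be taken entrywise. *)
Lemma coef_det_top (R : comNzRingType) m (A : 'M[{poly R}]_m) (d : 'I_m -> nat) :
  (forall i j, size (A i j) <= (d j).+1)%N ->
  (\det A)`_(\sum_j d j)%N = \det (\matrix_(i, j) (A i j)`_(d j)).
Proof.
move=> sA; rewrite /determinant coef_sum; apply: eq_bigr => s _.
have <- : (\prod_i A i (s i))`_(\sum_j d j)%N
        = \prod_i (\matrix_(i, j) (A i j)`_(d j)) i (s i).
  have -> : (\sum_j d j = \sum_j d (s j))%N.
    by rewrite (reindex_inj (@perm_inj _ s)).
  rewrite coef_prod_top //.
  by apply: eq_bigr => i _; rewrite mxE.
by rewrite !mulr_sign; case: ifP; rewrite ?coefN.
Qed.

Lemma det2E (R : comNzRingType) (A : 'M[R]_2) :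
  \det A = A 0 0 * A 1 1 - A 0 1 * A 1 0.
Proof.
rewrite (expand_det_row _ 0) !big_ord_recl big_ord0 /cofactor !det_mx11 !mxE.
have -> : lift 0 0 = 1 :> 'I_2 by apply/val_inj.
have -> : lift 1 0 = 0 :> 'I_2 by apply/val_inj.
rewrite /= !expr0 expr1; ring.
Qed.

Lemma det3E (R : comNzRingType) (f : nat -> nat -> R) :
  \det (\matrix_(i < 3, j < 3) f i j)
  = f 0%N 0%N * (f 1%N 1%N * f 2%N 2%N - f 1%N 2%N * f 2%N 1%N)
  - f 0%N 1%N * (f 1%N 0%N * f 2%N 2%N - f 1%N 2%N * f 2%N 0%N)
  + f 0%N 2%N * (f 1%N 0%N * f 2%N 1%N - f 1%N 1%N * f 2%N 0%N).
Proof.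
rewrite (expand_det_row _ 0) !big_ord_recl big_ord0 /cofactor !det2E !mxE /=.
rewrite /bump /= !expr0 ?expr1; ring.
Qed.

(** Eliminating the lower left block leaves the Schur complement of B. *)
Lemma det_block_schur (R : comUnitRingType) n1 n2 (B : 'M[R]_n1)
    (C : 'M[R]_(n1, n2)) (E : 'M[R]_(n2, n1)) (G : 'M[R]_n2) :
  B \in unitmx ->
  \det (block_mx B C E G) = \det B * \det (G - E *m invmx B *m C).
Proof.
move=> uB.
have -> : block_mx B C E G =
    block_mx 1%:M 0 (E *m invmx B) 1%:M *m
    block_mx B C 0 (G - E *m invmx B *m C).
  rewrite mulmx_block !mul1mx !mul0mx !addr0 !mulmxKV //.
  by rewrite -mulmxA addrC subrK.
by rewrite det_mulmx det_lblock !det1 !mul1r det_ublock.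
Qed.

Section ClosedFieldPolynomials.
Variable F : closedFieldType.
Implicit Type p : {poly F}.

Lemma poly_avoid (p : {poly F}) : p != 0 -> exists x, p.[x] != 0.
Proof. by move/closed_nonrootP. Qed.

Lemma poly_zero_everywhere (p : {poly F}) : (forall x, p.[x] = 0) -> p = 0.
Proof.
by move=> p0; apply/eqP/negP => /negP/poly_avoid[x]; rewrite p0 eqxx.
Qed.

Lemma finite_roots (p : {poly F}) : p != 0 -> exists s : seq F, forall x, root p x -> x \in s.
Proof.
move=> p0; have [s pE] := closed_field_poly_normal p; exists s => x.
by rewrite pE rootZ ?lead_coef_eq0 // root_prod_XsubC.
Qed.

End ClosedFieldPolynomials.

Section PolynomialCurves.
Variable R : comNzRingType.

Lemma horner_mmap n (P : {mpoly R[n]}) (h : 'I_n -> {poly R}) x :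
  (mmap polyC h P).[x] = P.@[fun j => (h j).[x]].
Proof.
rewrite /meval /mmap horner_sum; apply: eq_bigr => m _.
rewrite hornerM hornerC; congr (_ * _).
by rewrite /mmap1 horner_prod; apply: eq_bigr => i _; rewrite horner_exp.
Qed.

(** The chain rule along a polynomial curve h.  The polynomials P that satisfy it
    form a subalgebra, so constants and variables suffice. *)
Lemma deriv_mmap n (P : {mpoly R[n]}) (h : 'I_n -> {poly R}) :
  (mmap polyC h P)^`() = \sum_j mmap polyC h P^`M(j) * (h j)^`().
Proof.
pose K (p : {mpoly R[n]}) :=
  (mmap polyC h p)^`() = \sum_j mmap polyC h p^`M(j) * (h j)^`().
have KM p1 p2 : K p1 -> K p2 -> K (p1 * p2).
  rewrite /K rmorphM derivM => -> ->; rewrite mulr_suml mulr_sumr -big_split /=.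
  by apply: eq_bigr => j _; rewrite mderivM rmorphD !rmorphM /=; ring.
have KC a : K a%:MP.
  rewrite /K mmapC derivC big1 // => j _.
  by rewrite mderivC rmorph0 mul0r.
have KX i : K 'X_i.
  rewrite /K mmapX mmap1U (bigD1 i) //= big1 => [|j ji].
    rewrite mderivX mnm1E eqxx scale1r (_ : U_(i) - U_(i) = 0)%MM ?mpolyX0.
      by rewrite rmorph1 mul1r addr0.
    by apply/mnmP => j; rewrite mnmBE mnm0E subnn.
  by rewrite mderivX mnm1E eq_sym (negPf ji) scale0r rmorph0 mul0r.
rewrite -/(K P); elim/mpolyind: P => [|a m p _ _ Kp]; first exact: (KC 0).
rewrite /K mmapD derivD Kp.
have -> : (mmap polyC h (a *: 'X_[m]))^`() =
   \sum_j mmap polyC h (a *: 'X_[m])^`M(j) * (h j)^`().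
  rewrite -/(K _) -mul_mpolyC; apply: (KM) => //.
  rewrite mpolyXE_id; apply: big_ind => //; first exact: (KC 1).
  move=> i _; elim: (m i) => [|d IH]; first exact: (KC 1).
  by rewrite exprS; apply: KM.
rewrite -big_split /=; apply: eq_bigr => j _.
by rewrite mderivD rmorphD mulrDl.
Qed.

Definition affine_line (a v : R) : {poly R} := a%:P + v *: 'X.

Lemma horner_affine_line a v x : (affine_line a v).[x] = a + v * x.
Proof. by rewrite !hornerE. Qed.

Lemma deriv_affine_line a v : (affine_line a v)^`() = v%:P.
Proof. by rewrite derivD derivC add0r derivZ derivX alg_polyC. Qed.

End PolynomialCurves.

Section MultivariatePolynomials.
Variable F : fieldType.

Hypothesis char0 : [pchar F] =i pred0.

Lemma mpoly_const_of_deriv0 n (P : {mpoly F[n]}) :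
  (forall j, P^`M(j) = 0) -> P = (P@_0)%:MP.
Proof.
move=> dP; apply/mpolyP => m; rewrite mcoeffC.
have [->|m0] := eqVneq m 0%MM; first by rewrite mulr1.
rewrite mulr0; have [j mj] : exists j, m j != 0%N.
  apply/existsP; apply: contraR m0 => /existsPn m0.
  by apply/eqP/mnmP => j; rewrite mnm0E; apply/eqP; rewrite -[_ == _]negbK.
have := mcoeff_deriv j (m - U_(j))%MM P; rewrite dP mcoeff0.
have -> : (m - U_(j) + U_(j))%MM = m.
  by rewrite submK // lep1mP.
move/esym/eqP; rewrite -mulr_natr mulf_eq0 ((pcharf0P F).1 char0) orbF.
by move/eqP.
Qed.

Lemma msize_mderiv n (P : {mpoly F[n]}) j : P != 0 -> (msize P^`M(j) < msize P)%N.
Proof.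
move=> P0; have sP : (0 < msize P)%N by rewrite lt0n mmeasure_poly_eq0.
rewrite msizeE; case: (msize P) sP (@msize_mdeg_lt _ _ P) => // s _ lts.
rewrite ltnS; apply/bigmax_leqP_seq => m; rewrite mcoeff_msupp mcoeff_deriv => mP _.
have /lts : (m + U_(j))%MM \in msupp P.
  by rewrite mcoeff_msupp; apply: contraNneq mP => ->; rewrite mul0rn.
by rewrite mdegD mdeg1 addn1 ltnS.
Qed.

End MultivariatePolynomials.

Lemma dhomog_bigprod (R : comNzRingType) n (I : finType) (p : I -> {mpoly R[n]}) (e : I -> nat) :
  (forall i, p i \is (e i).-homog) -> \prod_i p i \is (\sum_i e i)%N.-homog.
Proof.
move=> pe; pose K (x : {mpoly R[n]}) m := x \is m.-homog.
apply: (big_ind2 K) => [|x1 e1 x2 e2 K1 K2|i _]; last exact: pe.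
  exact: dhomog1.
exact: dhomogM.
Qed.

Lemma clear_denominator (F : fieldType) (x y : F) a N : y != 0 -> (a <= N)%N ->
  y ^+ N * (x / y) ^+ a = x ^+ a * y ^+ (N - a).
Proof.
move=> y0 leaN; rewrite -{1}(subnK leaN) exprD exprMn exprVn mulrCA.
by rewrite mulfK ?expf_neq0.
Qed.

Section FiniteVectors.
Variable R : nzRingType.

(** Turns coefficients on the moments of index 1, ..., n into a linear functional
    on all moments: w0 is put at index 0, and zeros above n. *)
Definition extend_vec n (w0 : R) (w : 'I_n -> R) (r : nat) : R :=
  if r is j.+1 then oapp w 0 (insub j) else w0.

Lemma sum_extend_vec n N (w0 : R) (w : 'I_n -> R) (E : nat -> R) : (n < N)%N ->
  \sum_(r < N) extend_vec w0 w r * E r = w0 * E 0 + \sum_j w j * E j.+1.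
Proof.
case: N => // N lenN; rewrite big_ord_recl; congr (_ + _).
rewrite (eq_bigr (fun j : 'I_n => extend_vec w0 w j.+1 * E j.+1)); last first.
  by move=> j _; rewrite /= valK.
rewrite (big_ord_widen N (fun j => extend_vec w0 w j.+1 * E j.+1) lenN).
rewrite [RHS]big_mkcond; apply: eq_bigr => j _ /=.
by case: ifPn => // nj; rewrite /= insubN // mul0r.
Qed.

Definition dirac (i0 i : nat) : R := (i == i0)%:R.

Lemma sum_dirac k i0 (f : nat -> R) : (i0 < k)%N ->
  \sum_(i < k) dirac i0 i * f i = f i0.
Proof.
move=> lti; rewrite (bigD1 (Ordinal lti)) //= big1 => [|i].
  by rewrite /dirac eqxx mul1r addr0.
by rewrite -(inj_eq val_inj) /= /dirac => /negPf ->; rewrite mul0r.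
Qed.

End FiniteVectors.

(** * Generic tangent spaces and algebraic independence *)

Section TangentMatrix.
Variables (F : closedFieldType) (q : nat -> {poly F}).

(** The moments are theta^r q_r(kappa).  The rows s = 0, 1, 2 are the moment, its
    derivative in kappa and its image under theta d/dtheta; the Euler operator,
    unlike d/dtheta, keeps the factor theta^r. *)
Definition jet_coef (s r : nat) : {poly F} :=
  match s with 0 => q r | 1 => (q r)^`() | _ => r%:R *: q r end.

Definition jet (kappa theta : F) (s r : nat) : F :=
  theta ^+ r * (jet_coef s r).[kappa].

(** Row 3 i + s holds the s-th jet at the i-th point.  For n = 3k, this matrix is
    invertible exactly when the tangent spaces at the k points to the cone over
    the moment surface are independent, as in Terracini's lemma. *)
Definition jet_mx (n : nat) (kappa theta : nat -> F) : 'M[F]_n :=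
  \matrix_(l, r) jet (kappa (l %/ 3)%N) (theta (l %/ 3)%N) (l %% 3) r.

Definition poly_jet_mx (n : nat) (kappa theta : nat -> {poly F}) : 'M[{poly F}]_n :=
  \matrix_(l, r) (theta (l %/ 3)%N ^+ r *
                  (jet_coef (l %% 3) r \Po kappa (l %/ 3)%N)).

Lemma horner_det_poly_jet_mx n (kappa theta : nat -> {poly F}) x :
  (\det (poly_jet_mx n kappa theta)).[x]
  = \det (jet_mx n (fun i => (kappa i).[x]) (fun i => (theta i).[x])).
Proof.
rewrite -horner_evalE -det_map_mx; congr (\det _).
apply/matrixP => l r; rewrite !mxE /jet /=.
by rewrite /horner_eval hornerM horner_exp horner_comp.
Qed.

(** The leading coefficient, as theta tends to infinity, of the contribution of one
    point to the three columns r, r+1, r+2. *)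
Definition wronskian3 (r : nat) : {poly F} :=
  \det (\matrix_(s < 3, j < 3) jet_coef s (r + j)).

(** One more point (kappa0, theta) with theta an indeterminate.  After the old
    points are eliminated, the column n + j of the new 3 x 3 block has degree
    n + j in theta, and the correction coming from the columns of index below n
    has degree below n.  So the coefficient of highest degree of its determinant
    is the value at kappa0 of wronskian3. *)
Lemma jet_mx_inductive_step k (kappa theta : nat -> F) kappa0 :
  \det (jet_mx (k * 3) kappa theta) != 0 -> (wronskian3 (k * 3)).[kappa0] != 0 ->
  \det (poly_jet_mx (k * 3 + 3)
         (fun i => (if i == k then kappa0 else kappa i)%:P)
         (fun i => if i == k then 'X else (theta i)%:P)) != 0.
Proof.
move=> detB W0; set kp := fun i => _; set tp := fun i => _.
set n := (k * 3)%N in detB W0 *.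
set A := poly_jet_mx _ _ _.
rewrite -(submxK A).
have -> : ulsubmx A = map_mx polyC (jet_mx n kappa theta).
  apply/matrixP => l r; rewrite !mxE /=.
  have /negPf lk : (l %/ 3)%N != k by rewrite neq_ltn ltn_divLR ?ltn_ord.
  rewrite /kp /tp lk /jet rmorphM rmorphXn /=; congr (_ * _).
  by rewrite comp_polyCr.
set B := jet_mx n kappa theta in detB *.
have uB : B \in unitmx by rewrite unitmxE unitfE.
rewrite det_block_schur ?map_unitmx //.
rewrite mulf_neq0 ?det_map_mx ?polyC_eq0 //.
set G := drsubmx A; set E := dlsubmx A; set C := ursubmx A.
have ltB (l : 'I_n) : (l %/ 3 == k)%N = false.
  by apply/negbTE; rewrite neq_ltn ltn_divLR ?ltn_ord.
have ltS (s : 'I_3) : ((n + s) %/ 3 = k)%N.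
  by rewrite /n divnMDl // divn_small ?addn0.
have ltM (s : 'I_3) : ((n + s) %% 3 = s)%N.
  by rewrite /n modnMDl modn_small.
have EE s r : E s r = (jet_coef s r).[kappa0] *: 'X^r.
  by rewrite !mxE /= ltS ltM /kp /tp eqxx comp_polyCr -mul_polyC mulrC.
have GE s j : G s j = (jet_coef s (n + j)).[kappa0] *: 'X^(n + j).
  by rewrite !mxE /= ltS ltM /kp /tp eqxx comp_polyCr -mul_polyC mulrC.
have CE : C = map_mx polyC (\matrix_(l < n, j < 3)
     jet (kappa (l %/ 3)%N) (theta (l %/ 3)%N) (l %% 3) (n + j)).
  apply/matrixP => l j; rewrite !mxE /= /kp /tp ltB /jet rmorphM rmorphXn /=.
  by congr (_ * _); rewrite comp_polyCr.
set D := (M in map_mx _ M) in CE.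
have HE : G - E *m invmx (map_mx polyC B) *m C
        = G - E *m map_mx polyC (invmx B *m D).
  by rewrite CE -map_invmx -mulmxA -map_mxM.
rewrite HE; set K := invmx B *m D.
have sizeEK (s j : 'I_3) : (size ((E *m map_mx polyC K) s j) <= n)%N.
  rewrite mxE; apply: (leq_trans (size_sum _ _ _)); apply/bigmax_leqP => r _.
  rewrite EE [map_mx _ _ _ _]mxE mulrC mul_polyC scalerA.
  by apply: (leq_trans (size_scale_leq _ _)); rewrite size_polyXn.
apply/eqP => H0; move/eqP: W0; apply.
rewrite /wronskian3 -horner_evalE -det_map_mx.
(* The coefficient of theta^(3 n + 3) in the determinant of the Schur complement. *)
transitivity ((\det (G - E *m map_mx polyC K))`_(\sum_(j < 3) (n + j))%N);
  last by rewrite H0 coef0.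
have HEK s j : (G - E *m map_mx polyC K) s j = G s j - (E *m map_mx polyC K) s j.
  by rewrite [LHS]mxE; congr (_ + _); rewrite [LHS]mxE.
rewrite coef_det_top; last first.
  move=> s j.
  rewrite HEK; apply: (leq_trans (size_polyD _ _)).
  rewrite geq_max size_polyN GE (leq_trans (size_scale_leq _ _)) ?size_polyXn //=.
  by rewrite (leq_trans (sizeEK s j)) // leqW ?leq_addr.
congr (\det _); apply/matrixP => s j.
rewrite [LHS]mxE [RHS]mxE /= /horner_eval [X in X.[_]]mxE HEK coefB GE coefZ coefXn eqxx mulr1.
rewrite [X in _ - X]nth_default ?subr0 //.
by rewrite (leq_trans (sizeEK s j)) ?leq_addr.
Qed.

Hypothesis q0 : q 0 = 1.
Hypothesis wronskian3_neq0 : forall r, wronskian3 r != 0.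

(** The coordinates are kept nonzero so that the points come from parameters of the
    inverse Gaussian distribution, where kappa = mu / lambda and theta = mu. *)
Lemma generic_points k : exists kappa theta : nat -> F,
  (forall i, kappa i != 0 /\ theta i != 0) /\
  \det (jet_mx (k * 3) kappa theta) != 0.
Proof.
elim: k => [|k [kappa [theta [nz det_nz]]]].
  exists (fun=> 1), (fun=> 1); split=> [i|]; first by rewrite oner_neq0.
  by rewrite det_mx00 oner_neq0.
have /poly_avoid[kappa0] : wronskian3 (k * 3) * 'X != 0.
  by rewrite mulf_neq0 ?polyX_eq0.
rewrite hornerM hornerX mulf_eq0 negb_or => /andP[W0 kappa0_nz].
have /poly_avoid[x] : \det (poly_jet_mx (k * 3 + 3)
         (fun i => (if i == k then kappa0 else kappa i)%:P)
         (fun i => if i == k then 'X else (theta i)%:P)) * 'X != 0.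
  by rewrite mulf_neq0 ?polyX_eq0 ?jet_mx_inductive_step.
rewrite hornerM hornerX mulf_eq0 negb_or horner_det_poly_jet_mx.
move=> /andP[detx x_nz].
exists (fun i => if i == k then kappa0 else kappa i).
exists (fun i => if i == k then x else theta i).
split=> [i|]; first by case: (i == k); [split | apply: nz].
rewrite mulSn addnC; congr (\det (jet_mx _ _ _) != 0): detx.
- by apply/funext => i; rewrite hornerC.
- by apply/funext => i; case: (i == k); rewrite ?hornerX ?hornerC.
Qed.

Definition mixture_value k (c kappa theta : nat -> F) r :=
  \sum_(i < k) c i * jet (kappa i) (theta i) 0 r.

(** A polynomial condition that makes the differential of the mixture map
    injective: the jets are independent and no weight vanishes.  The conditions
    on kappa and theta keep the parameters in the domain of both families. *)
Definition regular k (c kappa theta : nat -> F) :=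
  \det (jet_mx (k * 3) kappa theta) *
    \prod_(i < k) (c i * kappa i * theta i) != 0.

Lemma jet_kernel k (kappa theta : nat -> F) (w : nat -> F) :
  \det (jet_mx (k * 3) kappa theta) != 0 ->
  (forall i s, (i < k)%N -> (s < 3)%N ->
     \sum_(r < k * 3) w r * jet (kappa i) (theta i) s r = 0) ->
  forall r, (r < k * 3)%N -> w r = 0.
Proof.
move=> det_nz w0 r ltr.
pose v : 'cV[F]_(k * 3) := \col_r w r.
suff /matrixP/(_ (Ordinal ltr) 0) : v = 0 by rewrite !mxE.
have uJ : jet_mx (k * 3) kappa theta \in unitmx by rewrite unitmxE unitfE.
rewrite -[v](mulKmx uJ) [X in _ *m X](_ : _ = 0) ?mulmx0 //.
apply/matrixP => l j; rewrite [LHS]mxE [RHS]mxE.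
rewrite -[RHS](w0 (l %/ 3)%N (l %% 3)%N) ?ltn_divLR ?ltn_pmod //.
by apply: eq_bigr => i _; rewrite !mxE mulrC.
Qed.

Section Curve.
Variables (k : nat) (c kappa theta dc dkappa dtheta : nat -> F).

Definition mixture_line r : {poly F} :=
  \sum_(i < k) affine_line (c i) (dc i) *
     (affine_line (theta i) (dtheta i) ^+ r *
      (q r \Po affine_line (kappa i) (dkappa i))).

Let at_ (x : F) (a v : nat -> F) i := a i + v i * x.

Lemma horner_mixture_line r x :
  (mixture_line r).[x] =
  mixture_value k (at_ x c dc) (at_ x kappa dkappa) (at_ x theta dtheta) r.
Proof.
rewrite horner_sum; apply: eq_bigr => i _.
by rewrite !(hornerM, horner_exp, horner_comp) !horner_affine_line.
Qed.

Lemma deriv_mixture_line r :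
  (mixture_line r)^`().[0] =
  \sum_(i < k) (dc i * jet (kappa i) (theta i) 0 r
    + c i * (dkappa i * jet (kappa i) (theta i) 1 r
    + dtheta i * (theta i ^+ r.-1 *+ r * (q r).[kappa i]))).
Proof.
rewrite (raddf_sum (@deriv F)) horner_sum; apply: eq_bigr => i _.
rewrite /= !derivM deriv_exp deriv_comp !deriv_affine_line.
rewrite /affine_line !(hornerD, hornerM, horner_exp, horner_comp, hornerMn,
  hornerZ, hornerX, hornerC) !mulr0 !addr0 /jet /=; ring.
Qed.

(** Regularity is the nonvanishing of a polynomial, so on a line through a regular
    point it fails at finitely many points only. *)
Lemma regular_on_line : regular k c kappa theta ->
  exists2 D : {poly F}, D != 0 & forall x, D.[x] != 0 ->
    regular k (at_ x c dc) (at_ x kappa dkappa) (at_ x theta dtheta).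
Proof.
move=> reg.
pose lc i := affine_line (c i) (dc i).
pose lk i := affine_line (kappa i) (dkappa i).
pose lt i := affine_line (theta i) (dtheta i).
pose D := \det (poly_jet_mx (k * 3) lk lt) * \prod_(i < k) (lc i * lk i * lt i).
have DE x : D.[x] = \det (jet_mx (k * 3) (at_ x kappa dkappa) (at_ x theta dtheta))
    * \prod_(i < k) (at_ x c dc i * at_ x kappa dkappa i * at_ x theta dtheta i).
  rewrite hornerM horner_det_poly_jet_mx horner_prod.
  congr (\det (jet_mx _ _ _) * _).
  - by apply/funext => i; rewrite horner_affine_line.
  - by apply/funext => i; rewrite horner_affine_line.
  - by apply: eq_bigr => i _; rewrite !hornerM !horner_affine_line.
exists D => [|x]; last by rewrite DE.
apply: contraTneq reg => D0.
have at0 (a v : nat -> F) : at_ 0 a v = a.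
  by apply/funext => i; rewrite /at_ mulr0 addr0.
by have := DE 0; rewrite D0 horner0 !at0 /regular negbK => <-.
Qed.

End Curve.

Hypothesis char0 : [pchar F] =i pred0.

Section Gradient.
Variables (n k : nat) (P : {mpoly F[n]}).
Hypothesis ltnk : (n < k * 3)%N.
Hypothesis P_vanishes : forall c kappa theta : nat -> F, \sum_(i < k) c i = 1 ->
  regular k c kappa theta ->
  P.@[fun j => mixture_value k c kappa theta j.+1] = 0.
Variables c kappa theta : nat -> F.
Hypothesis sum_c : \sum_(i < k) c i = 1.
Hypothesis reg : regular k c kappa theta.

Let w (j : 'I_n) := P^`M(j).@[fun j => mixture_value k c kappa theta j.+1].

(** P vanishes on the image of a line inside the hyperplane of weights of sum 1,
    except possibly at finitely many points, hence on the whole image; the chain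
    rule then gives a relation on the gradient of P. *)
Lemma gradient_along (dc dkappa dtheta : nat -> F) : \sum_(i < k) dc i = 0 ->
  \sum_j w j * (mixture_line k c kappa theta dc dkappa dtheta j.+1)^`().[0] = 0.
Proof.
move=> sum_dc; set L := mixture_line _ _ _ _ _ _ _.
have [D D0 regD] := regular_on_line dc dkappa dtheta reg.
pose g := mmap polyC (fun j : 'I_n => L j.+1) P.
have g0 : g = 0.
  apply/eqP; have : g * D = 0.
    apply: poly_zero_everywhere => x; rewrite hornerM.
    have [->|/regD regx] := eqVneq D.[x] 0; first by rewrite mulr0.
    rewrite horner_mmap -[RHS](mul0r D.[x]); congr (_ * _).
    rewrite -[RHS](P_vanishes _ regx); first last.
      by rewrite big_split /= sum_c -mulr_suml sum_dc mul0r addr0.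
    by apply: meval_eq => j; rewrite horner_mixture_line.
  by move/eqP; rewrite mulf_eq0 (negPf D0) orbF.
have : g^`().[0] = 0 by rewrite g0 deriv0 horner0.
rewrite deriv_mmap horner_sum => gs; rewrite -[RHS]gs; apply: eq_bigr => j _.
rewrite hornerM horner_mmap; congr (_ * _); apply: meval_eq => i.
rewrite horner_mixture_line; congr (mixture_value _ _ _ _ _);
  by apply/funext => l; rewrite mulr0 addr0.
Qed.

(** The gradient w of P, completed at index 0, is orthogonal to all 3k jets, which
    form a basis.  Directions that move weight from the 0-th to the i-th
    component show that the sum of w_j m_(j+1)(t_i) over j does not depend on i;
    minus this value is the completion t0 at index 0, where every moment is 1.
    The other jets are zero at index 0. *)
Lemma gradient_vanishes j : w j = 0.
Proof.
have k_gt0 : (0 < k)%N by case: (k) ltnk.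
move: (reg); rewrite /regular mulf_eq0 negb_or => /andP[det_nz /prodf_neq0 nz].
have c_nz i : (i < k)%N -> c i != 0.
  by move=> lti; move: (nz (Ordinal lti) isT); rewrite !mulf_eq0 !negb_or -andbA => /and3P[].
pose t0 := - \sum_j w j * jet (kappa 0%N) (theta 0%N) 0 j.+1.
suff /(_ j.+1) : forall r, (r < k * 3)%N -> extend_vec t0 w r = 0.
  by rewrite /= valK /=; apply; apply: leq_ltn_trans ltnk.
have z0 : \sum_(i < k) (fun=> 0 : F) (i : nat) = 0 by rewrite big1.
apply: (jet_kernel det_nz) => i s lti lts.
rewrite (sum_extend_vec _ _ _ ltnk).
case: s lts => [|[|[|//]]] _.
- rewrite /t0 [jet _ _ _ 0]/= /jet expr0 mul1r /= q0 hornerC mulr1 addrC -sumrB.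
  rewrite -[RHS](@gradient_along (fun l => dirac F i l - dirac F 0%N l) (fun=> 0) (fun=> 0)).
    apply: eq_bigr => l _; rewrite -mulrBr; congr (_ * _).
    rewrite deriv_mixture_line.
    under eq_bigr do rewrite !mul0r !addr0 mulr0 addr0 mulrBl.
    by rewrite sumrB !(sum_dirac (fun l => jet (kappa l) (theta l) 0 _)).
  under eq_bigr do rewrite -[_ - _]mulr1 mulrBl.
  by rewrite sumrB !(sum_dirac (fun=> 1)) // subrr.
- rewrite {1}/jet /= q0 derivC horner0 !mulr0 add0r; apply: (mulfI (c_nz i lti)).
  rewrite mulr0 -[RHS](@gradient_along (fun=> 0) (dirac F i) (fun=> 0) z0).
  rewrite mulr_sumr; apply: eq_bigr => l _; rewrite mulrCA; congr (_ * _).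
  rewrite deriv_mixture_line.
  under eq_bigr do rewrite !mul0r add0r addr0 mulrCA.
  by rewrite (sum_dirac (fun m => c m * jet (kappa m) (theta m) 1 _)).
- rewrite {1}/jet /= scale0r horner0 !mulr0 add0r; apply: (mulfI (c_nz i lti)).
  rewrite mulr0 -[RHS](mulr0 (theta i)).
  rewrite -[X in _ = _ * X](@gradient_along (fun=> 0) (fun=> 0) (dirac F i) z0).
  rewrite !mulr_sumr; apply: eq_bigr => l _; rewrite mulrCA [RHS]mulrCA; congr (_ * _).
  rewrite deriv_mixture_line.
  under [in RHS]eq_bigr do rewrite !mul0r !add0r mulrCA.
  rewrite (sum_dirac (fun m => c m * (theta m ^+ l.+1.-1 *+ l.+1 * (q l.+1).[kappa m]))) //.
  by rewrite /jet /= hornerZ exprS -mulr_natr; ring.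
Qed.

End Gradient.

(** The Jacobian criterion: the partial derivatives of a relation P are relations of
    smaller degree, so they vanish by induction, and in characteristic 0 the
    polynomial P is constant. *)
Lemma mixtures_independent n k (P : {mpoly F[n]}) : (n < k * 3)%N ->
  (forall c kappa theta : nat -> F, \sum_(i < k) c i = 1 ->
     regular k c kappa theta ->
     P.@[fun j => mixture_value k c kappa theta j.+1] = 0) -> P = 0.
Proof.
move=> ltnk; have [s] := ubnP (msize P); elim: s P => // s IH P leP P_van.
apply/eqP/negP => /negP P0.
have dP j : P^`M(j) = 0.
  apply: IH => [|c kappa theta sc reg].
    by apply: leq_trans (msize_mderiv j P0) _; rewrite -ltnS.
  exact: (gradient_vanishes ltnk P_van sc reg).
have k_nz : k%:R != 0 :> F by rewrite ((pcharf0P F).1 char0); case: (k) ltnk.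
have [kappa [theta [nz det_nz]]] := generic_points k.
(* A constant relation is zero because some regular normalized mixture exists. *)
have := P_van (fun=> k%:R^-1) kappa theta.
rewrite (mpoly_const_of_deriv0 char0 dP) mevalC => P00.
move: P0; rewrite (mpoly_const_of_deriv0 char0 dP) P00 ?mpolyC0 ?eqxx //.
  by rewrite sumr_const card_ord -[LHS]mulr_natr mulVf.
rewrite /regular mulf_neq0 //; apply/prodf_neq0 => i _.
by rewrite !mulf_neq0 ?invr_eq0 // ?(nz i).1 ?(nz i).2.
Qed.

End TangentMatrix.

(** * Moments of the two families as polynomials *)

Section MomentPolynomials.

(** With nu = 1 / lambda the inverse Gaussian moments are polynomials.  An arbitrary
    coefficient ring allows parameters that are themselves polynomials. *)
Fixpoint ig_moment_poly (A : comNzRingType) (mu nu : A) (r : nat) : A :=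
  match r with
  | 0 => 1
  | s.+1 =>
    match s with
    | 0 => mu
    | t.+1 => ((2 * r)%:R - 3%:R) * nu * mu ^+ 2 * ig_moment_poly mu nu s
              + mu ^+ 2 * ig_moment_poly mu nu t
    end
  end.

Definition moment_poly (A : comNzRingType) (D : moment_family) (a b : A) r : A :=
  match D with
  | InverseGaussian => ig_moment_poly a b r
  | Gamma => b ^+ r * \prod_(i < r) (i%:R + a)
  end.

Lemma nat_ind2 (P : nat -> Prop) :
  P 0 -> P 1 -> (forall n, P n -> P n.+1 -> P n.+2) -> forall n, P n.
Proof.
move=> P0 P1 IH n; suff [] : P n /\ P n.+1 by [].
by elim: n => // n [Pn Pn1]; split=> //; apply: IH.
Qed.

Lemma ig_moment_polySS (A : comNzRingType) (a b : A) r :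
  ig_moment_poly a b r.+2 =
  ((2 * r.+2)%:R - 3%:R) * b * a ^+ 2 * ig_moment_poly a b r.+1
   + a ^+ 2 * ig_moment_poly a b r.
Proof. by []. Qed.

Lemma rmorph_moment_poly (A B : comNzRingType) (f : {rmorphism A -> B}) D a b r :
  f (moment_poly D a b r) = moment_poly D (f a) (f b) r.
Proof.
case: D => /=.
  elim/nat_ind2: r => [||r IH0 IH1]; rewrite ?rmorph1 //.
  rewrite !ig_moment_polySS rmorphD !rmorphM rmorphB !rmorph_nat.
  by rewrite IH0 IH1.
rewrite rmorphM rmorphXn rmorph_prod; congr (_ * _).
by apply: eq_bigr => i _; rewrite rmorphD rmorph_nat.
Qed.

Lemma moment_poly0 (A : comNzRingType) D (a b : A) : moment_poly D a b 0 = 1.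
Proof. by case: D => //=; rewrite big_ord0 expr0 mulr1. Qed.

Variable F : closedFieldType.

(** The coordinates in which the moments are polynomials: (mu, 1 / lambda), resp.
    (kappa, theta). *)
Definition chart (D : moment_family) (t : F * F) : F * F :=
  match D with InverseGaussian => (t.1, t.2^-1) | Gamma => t end.

Lemma chartK D : involutive (chart D).
Proof. by case: D => -[x y] //=; rewrite invrK. Qed.

Lemma momentE D (t : F * F) r :
  moment D t r = moment_poly D (chart D t).1 (chart D t).2 r.
Proof.
case: D => //=; elim/nat_ind2: r => // r IH0 IH1.
by rewrite ig_moment_polySS -IH0 -IH1.
Qed.

(** The polynomials q_r such that the moments are theta^r q_r(kappa); those of the
    inverse Gaussian distribution are Bessel polynomials. *)
Definition shape_poly (D : moment_family) (r : nat) : {poly F} :=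
  match D with
  | InverseGaussian => ig_moment_poly 1 'X r
  | Gamma => \prod_(i < r) (i%:R + 'X)
  end.

(** The parameters with given kappa and theta; for the inverse Gaussian
    distribution mu = theta and mu / lambda = kappa. *)
Definition shape_scale (D : moment_family) (kappa theta : F) : F * F :=
  match D with InverseGaussian => (theta, theta / kappa) | Gamma => (kappa, theta) end.

Lemma shape_scale_domain D kappa theta : kappa != 0 -> theta != 0 ->
  param_domain D (shape_scale D kappa theta).
Proof. by case: D => // k0 t0; rewrite /= mulf_neq0 ?invr_eq0. Qed.

Lemma moment_shape_scale D kappa theta r : theta != 0 ->
  moment D (shape_scale D kappa theta) r = jet (shape_poly D) kappa theta 0 r.
Proof.
move=> t0; rewrite momentE /jet; case: D => /=; last first.
  by rewrite horner_prod; congr (_ * _); apply: eq_bigr => i _; rewrite !hornerE hornerMn hornerC.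
rewrite invf_div; elim/nat_ind2: r => [||r IH0 IH1].
- by rewrite expr0 hornerC mulr1.
- by rewrite expr1 /= hornerC mulr1.
rewrite !ig_moment_polySS IH0 IH1 expr1n !mulr1 mul1r.
rewrite hornerD !hornerM hornerX.
have -> : ((2 * r.+2)%:R - 3%:R : {poly F}).[kappa] = (2 * r.+2)%:R - 3%:R.
  by rewrite -!polyC_natr -polyCB hornerC.
rewrite !exprS; field.
by [].
Qed.

Lemma shape_poly0 D : shape_poly D 0 = 1.
Proof. by case: D => //=; rewrite big_ord0. Qed.

Lemma wronskian3_gamma r :
  wronskian3 (shape_poly Gamma) r = shape_poly Gamma r ^+ 3 * ('X + r%:R).
Proof.
have qS n : shape_poly Gamma n.+1 = shape_poly Gamma n * (n%:R + 'X).
  by rewrite /= big_ord_recr.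
rewrite /wronskian3 (det3E (fun s j => jet_coef _ s (r + j))).
rewrite addn0 addn1 addn2 /jet_coef !qS.
set q := shape_poly Gamma r.
have dn n : (n%:R : {poly F})^`() = 0 by rewrite -polyC_natr derivC.
rewrite !(derivM, derivD) !dn !derivX.
rewrite -!mul_polyC !polyC_natr; ring.
Qed.

Hypothesis char0 : [pchar F] =i pred0.

Lemma ig_shape_at0 r : (shape_poly InverseGaussian r).[0] = 1.
Proof.
elim/nat_ind2: r => [||r IH0 IH1]; rewrite /shape_poly ?hornerC //.
rewrite ig_moment_polySS expr1n mul1r mulr1 hornerD !hornerM hornerX.
by rewrite mulr0 mul0r add0r; exact: IH0.
Qed.

(** The factor 2 clears the denominator of r (r - 1) / 2, the linear coefficient of
    the r-th Bessel polynomial. *)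
Lemma ig_shape_deriv_at0 r :
  2%:R * (shape_poly InverseGaussian r)^`().[0] = r%:R * (r%:R - 1).
Proof.
elim/nat_ind2: r => [||r IH0 IH1].
- by rewrite derivC horner0 mulr0 mul0r.
- by rewrite derivC horner0 mulr0 subrr mulr0.
rewrite /shape_poly ig_moment_polySS !expr1n mulr1 mul1r derivD hornerD mulrDr IH0.
rewrite -mulrA derivM hornerD hornerM derivM.
have -> : ((2 * r.+2)%:R - 3%:R : {poly F}) = ((2 * r.+2)%:R - 3%:R)%:P.
  by rewrite -!polyC_natr -polyCB.
rewrite derivC horner0 mul0r add0r hornerM hornerC hornerD !hornerM.
rewrite derivX hornerC hornerX [X in 1 * X](ig_shape_at0 r.+1).
rewrite natrM -!natr1; ring.
Qed.

(** At kappa = 0 all the q_j are 1, and the determinant becomes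
    2 q_(r+1)' - q_(r+2)' - q_r', minus a second difference of j (j - 1) / 2. *)
Lemma wronskian3_ig_at0 r :
  2%:R * (wronskian3 (shape_poly InverseGaussian) r).[0] = - 2%:R.
Proof.
rewrite /wronskian3 (det3E (fun s j => jet_coef _ s (r + j))).
rewrite addn0 addn1 addn2 /jet_coef.
have := ig_shape_deriv_at0 r.+2; have := ig_shape_deriv_at0 r.+1.
have := ig_shape_deriv_at0 r; have := ig_shape_at0 r.+2.
have := ig_shape_at0 r.+1; have := ig_shape_at0 r.
move: (shape_poly _ r.+2) (shape_poly _ r.+1) (shape_poly _ r) => p2 p1 p0.
move=> e0 e1 e2 d0 d1 d2.
have [r1 r2] : r.+1%:R = r%:R + 1 :> F /\ r.+2%:R = r%:R + 2%:R :> F.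
  by rewrite -addn2 -addn1 !natrD.
rewrite !(hornerD, hornerN, hornerM, hornerZ) e0 e1 e2 r1 r2.
rewrite r1 in d1; rewrite r2 in d2.
transitivity (2%:R * (2%:R * p1^`().[0]) - 2%:R * p2^`().[0] - 2%:R * p0^`().[0]).
  by ring.
by rewrite d0 d1 d2; ring.
Qed.

Lemma shape_wronskian3_neq0 D r : wronskian3 (shape_poly D) r != 0.
Proof.
case: D.
  apply/eqP => W0; have := wronskian3_ig_at0 r.
  rewrite W0 horner0 mulr0 => /esym/eqP.
  by rewrite oppr_eq0 ((pcharf0P F).1 char0).
have nz n : n%:R + 'X != 0 :> {poly F}.
  by rewrite addrC -polyC_natr -size_poly_eq0 size_XaddC.
rewrite wronskian3_gamma mulf_neq0 //; last by rewrite addrC.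
by rewrite expf_neq0 //; apply/prodf_neq0 => i _.
Qed.

End MomentPolynomials.

(** * Algebraic dependence by counting monomials *)

Section AlgebraicDependence.
Variable F : fieldType.

Lemma msize_prod_bound n (I : finType) (p : I -> {mpoly F[n]}) (d : I -> nat) :
  (forall i, msize (p i) <= (d i).+1)%N ->
  (msize (\prod_i p i) <= (\sum_i d i).+1)%N.
Proof.
move=> pd; pose K (x : {mpoly F[n]}) e := (msize x <= e.+1)%N.
apply: (big_ind2 K) => [|x1 e1 x2 e2 K1 K2|i _]; [by rewrite /K msize1| |exact: pd].
have [->|x1nz] := eqVneq x1 0; first by rewrite /K mul0r msize0.
have [->|x2nz] := eqVneq x2 0; first by rewrite /K mulr0 msize0.
rewrite /K msizeM // -subn1 leq_subLR add1n -addSn -addnS.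
exact: leq_add K1 K2.
Qed.

Lemma msize_exp_bound n (p : {mpoly F[n]}) d e :
  (msize p <= d.+1)%N -> (msize (p ^+ e) <= (e * d).+1)%N.
Proof.
move=> pd; have := @msize_prod_bound n 'I_e (fun=> p) (fun=> d) (fun=> pd).
by rewrite prodr_const sum_nat_const card_ord.
Qed.

(** Polynomials of degree at most N lie in a space spanned by the (N+1)^n monomials
    with exponents at most N. *)
Lemma linear_dependence_bounded n N (I : finType) (g : I -> {mpoly F[n]}) :
  (forall i, msize (g i) <= N.+1)%N -> (N.+1 ^ n < #|I|)%N ->
  exists2 x : {ffun I -> F}, x != 0 & \sum_i x i *: g i = 0.
Proof.
move=> gN ltI.
pose T := {ffun 'I_n -> 'I_N.+1}.
pose mon (b : T) : 'X_{1..n} := [multinom (b j : nat) | j < n].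
pose M := \matrix_(i < #|I|, b < #|{: T}|) (g (enum_val i))@_(mon (enum_val b)).
have : kermx M != 0.
  rewrite kermx_eq0 /row_free neq_ltn (leq_ltn_trans (rank_leq_col M)) //.
  by rewrite card_ffun !card_ord.
case/rowV0Pn => v /sub_kermxP vM v0.
exists [ffun i => v 0 (enum_rank i)].
  apply: contraNneq v0 => x0; apply/eqP/rowP => i.
  by have /ffunP/(_ (enum_val i)) := x0; rewrite !ffunE enum_valK mxE.
apply/mpolyP => m; rewrite mcoeff0 raddf_sum /=.
have [ltm|] := boolP [forall j, m j < N.+1]%N; last first.
  rewrite negb_forall => /existsP[j]; rewrite -leqNgt => ltj.
  rewrite big1 // => i _; rewrite mcoeffZ [X in _ * X](_ : _ = 0) ?mulr0 //.
  apply/eqP; rewrite mcoeff_eq0 msize_mdeg_ge // (leq_trans (gN i)) //.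
  by rewrite mdegE (bigD1 j) //= (leq_trans ltj) // leq_addr.
pose b : T := [ffun j => inord (m j)].
have -> : m = mon b.
  apply/mnmP => j; rewrite mnmE ffunE inordK //; exact: (forallP ltm).
move/rowP: vM => /(_ (enum_rank b)); rewrite [LHS]mxE [RHS]mxE => vMb; rewrite -[RHS]vMb.
rewrite [RHS](reindex (@enum_rank I)) /=; last first.
  by apply: onW_bij; apply: enum_rank_bij.
apply: eq_bigr => i _; rewrite mcoeffZ ffunE; congr (_ * _).
by rewrite mxE !enum_rankK.
Qed.

(** Multiplied by the N-th power of the denominators w, the (N+1)^m monomials in the
    fractions u / w become polynomials of degree at most m D N, if D bounds all
    degrees.  There are more of them than the (m D N + 1)^n available monomials
    once N >= (m D)^n and m > n. *)
Lemma algebraic_dependence n m (u w : 'I_m -> {mpoly F[n]}) : (n < m)%N ->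
  exists N, exists2 x : {ffun {ffun 'I_m -> 'I_N.+1} -> F}, x != 0 &
    \sum_a x a *: \prod_i (u i ^+ a i * w i ^+ (N - a i)) = 0.
Proof.
move=> ltnm.
pose D := (\max_i maxn (msize (u i)) (msize (w i))).+1.
have uD i : (msize (u i) <= D.+1)%N.
  by do 2 apply: leqW; apply: leq_trans (leq_bigmax i); exact: leq_maxl.
have wD i : (msize (w i) <= D.+1)%N.
  by do 2 apply: leqW; apply: leq_trans (leq_bigmax i); exact: leq_maxr.
(* Then (m D N + 1)^n <= (m D (N + 1))^n = N (N + 1)^n < (N + 1)^m. *)
pose N := ((m * D) ^ n)%N; exists N.
apply: (@linear_dependence_bounded _ (m * (N * D))%N) => [a|].
  apply: leq_trans (msize_prod_bound (d := fun=> (N * D)%N) _) _ => [i|].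
    have aN : (a i <= N)%N by rewrite -ltnS.
    have := @msize_prod_bound n bool (fun b => if b then u i ^+ a i else w i ^+ (N - a i))
       (fun b => if b then (a i * D)%N else ((N - a i) * D)%N).
    rewrite !big_bool /= -mulnDl subnKC //; apply.
    by case; apply: msize_exp_bound.
  by rewrite sum_nat_const card_ord.
rewrite card_ffun !card_ord.
have mD : (0 < m * D)%N by rewrite muln_gt0 (leq_trans _ ltnm).
apply: (@leq_ltn_trans ((m * D * N.+1) ^ n)).
  move: N => N; case: (n) => [|e] //; rewrite leq_exp2r // mulnS.
  by rewrite [(N * D)%N]mulnC mulnA -addn1 addnC leq_add2r.
rewrite expnMn -/N; apply: (@leq_trans (N.+1 ^ n.+1)).
  by rewrite expnS ltn_pmul2r ?expn_gt0.
by rewrite leq_pexp2l.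
Qed.

End AlgebraicDependence.

(** * Projective space: closures and transcendence degree *)

Section Projective.
Variable F : closedFieldType.

Variable d : nat.
Implicit Types (x y : proj_space F d) (S Z : set (proj_space F d)).
Implicit Types (p h : {mpoly F[d.+1]}) (v w : 'rV[F]_d.+1).

Lemma hcoords_neq0 x v : hcoords x v -> v != 0.
Proof.
rewrite /hcoords => xv; apply/eqP => v0; have := valP x.
by rewrite xv dim_vline v0 eqxx.
Qed.

Lemma hcoords_exists v : v != 0 -> exists x, hcoords x v.
Proof.
move=> v0; have dimv : \dim <[v]> == 1%N by rewrite dim_vline v0.
by exists (exist _ <[v]>%VS dimv).
Qed.

Lemma hcoords_memP x v : v \in \val x -> v != 0 -> hcoords x v.
Proof.
move=> xv v0; rewrite /hcoords; apply/esym/eqP.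
by rewrite eqEdim -memvE xv dim_vline v0 (eqP (valP x)).
Qed.

Lemma hcoords_scale x v w : hcoords x v -> w \in \val x ->
  exists s, w = s *: v.
Proof. by rewrite /hcoords => -> /vlineP. Qed.

Lemma proj_hcoords x : exists v, hcoords x v.
Proof.
exists (vpick (\val x)); apply: hcoords_memP; first exact: memv_pick.
by rewrite vpick0 -dimv_eq0 (eqP (valP x)).
Qed.

Lemma hcoords_mem x v : hcoords x v -> v \in \val x.
Proof. by rewrite /hcoords => ->; apply: memv_line. Qed.

Lemma evalvZ e p s v : p \is e.-homog -> evalv p (s *: v) = s ^+ e * evalv p v.
Proof.
move/dhomogP => pe; rewrite /evalv !mevalE mulr_sumr big_seq [RHS]big_seq.
apply: eq_bigr => m /pe /= <-; rewrite mulrCA; congr (_ * _).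
rewrite mdegE -prodrXr -big_split /=; apply: eq_bigr => i _.
by rewrite mxE exprMn.
Qed.

(** The restriction of p to the line is a univariate polynomial with infinitely many
    zeros. *)
Lemma evalv_line_limit p v w :
  (forall s, s != 0 -> evalv p (v + s *: w) = 0) -> evalv p v = 0.
Proof.
move=> p0; pose g := mmap polyC (fun r : 'I_d.+1 => affine_line (v 0 r) (w 0 r)) p.
have gE s : g.[s] = evalv p (v + s *: w).
  rewrite horner_mmap; apply: meval_eq => r.
  by rewrite !mxE horner_affine_line mulrC.
have g0 : g = 0.
  apply/eqP; have : g * 'X = 0.
    apply: poly_zero_everywhere => s; rewrite hornerM hornerX.
    have [->|s0] := eqVneq s 0; first by rewrite mulr0.
    by rewrite gE p0 ?mul0r.
  by move/eqP; rewrite mulf_eq0 polyX_eq0 orbF.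
by have := gE 0; rewrite g0 horner0 scale0r addr0.
Qed.

Lemma vanishes_atP e p x v : p \is e.-homog -> hcoords x v ->
  vanishes_at p x <-> evalv p v = 0.
Proof.
move=> pe xv; split=> [/(_ v xv) //|pv w xw].
have [s ->] := hcoords_scale xv (hcoords_mem xw).
by rewrite (evalvZ _ _ pe) pv mulr0.
Qed.

Lemma sub_zariski_closure S : S `<=` zariski_closure S.
Proof. by move=> x Sx e p _; apply. Qed.

Lemma zariski_closure_sub S Z : zariski_closed Z -> S `<=` Z ->
  zariski_closure S `<=` Z.
Proof.
move=> <- SZ x clx e p pe pZ; apply: (clx e p pe) => y /SZ.
by move/(_ e p pe); apply.
Qed.

Lemma zariski_closureK S : zariski_closed (zariski_closure S).
Proof.
apply/seteqP; split; last exact: sub_zariski_closure.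
by move=> x clx e p pe pS; apply: (clx e p pe) => y /(_ e p pe); apply.
Qed.

Lemma zeros_closed e p : p \is e.-homog -> zariski_closed [set x | vanishes_at p x].
Proof.
move=> pe; apply/seteqP; split; last exact: sub_zariski_closure.
by move=> x /(_ e p pe); apply.
Qed.

(** Zariski closures only involve homogeneous polynomials.  An arbitrary h that
    vanishes on a cone has all its homogeneous parts vanishing there, since
    s |-> h (s v) is a polynomial in s with those parts as coefficients. *)
Lemma closure_cone S h :
  (forall x v, S x -> v \in \val x -> evalv h v = 0) ->
  forall x v, zariski_closure S x -> v \in \val x -> evalv h v = 0.
Proof.
move=> hS; pose K := msize h; pose he e := pihomog mdeg e h.
have heH e : he e \is e.-homog by apply: pihomogP.
have hE u : evalv h u = \sum_(e < K) evalv (he e) u.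
  rewrite {1}(pihomog_partitionE (mf := mdeg) (k := K) (p := h)) //.
  by rewrite /evalv raddf_sum.
have he0 e x : (e < K)%N -> S x -> vanishes_at (he e) x.
  move=> ltK Sx v xv.
  pose g := \poly_(e < K) evalv (he e) v.
  have g0 : g = 0.
    apply: poly_zero_everywhere => s; rewrite horner_poly -[RHS](hS x (s *: v)) //.
      by rewrite hE; apply: eq_bigr => i _; rewrite (evalvZ _ _ (heH i)) mulrC.
    by rewrite memvZ ?hcoords_mem.
  by have := coef_poly K (fun e => evalv (he e) v) e; rewrite -/g g0 coef0 ltK.
move=> x v clx xv; rewrite hE big1 // => e _.
have [u xu] := proj_hcoords x; have [s ->] := hcoords_scale xu xv.
by rewrite (evalvZ _ _ (heH e)) (clx e _ (heH e)) ?mulr0 // => y; apply: he0.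
Qed.

(** The hypothesis says that the image of phi is dense enough to detect the
    homogeneous polynomials vanishing on Z.  A relation between the pullbacks by
    phi of numerators and denominators, homogenized by the denominators, is such
    a polynomial, hence is a relation between the fractions on Z.  Since this
    holds for all Z in the closure of the image, it also covers proper closed
    subsets, where the number of independent fractions could only drop. *)
Lemma trdeg_ge_le n m Z (phi : 'I_d.+1 -> {mpoly F[n]}) :
  (forall e p, p \is e.-homog ->
     (forall t, evalv p (\row_i (phi i).@[t]) = 0) ->
     forall x, Z x -> vanishes_at p x) ->
  trdeg_ge Z m -> (m <= n)%N.
Proof.
move=> phiZ [f [g [frac indep]]]; rewrite leqNgt; apply/negP => ltnm.
pose sub p := p \mPo [tuple phi i | i < d.+1].
have subE p t : (sub p).@[t] = evalv p (\row_i (phi i).@[t]).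
  rewrite /sub comp_mpoly_meval /evalv; apply: meval_eq => i.
  by rewrite tnth_mktuple mxE.
have [N [x x0 rel]] := algebraic_dependence (sub \o f) (sub \o g) ltnm.
pose mon (a : {ffun 'I_m -> 'I_N.+1}) : 'X_{1..m} := [multinom (a i : nat) | i < m].
have mon_inj : injective mon.
  by move=> a b /mnmP ab; apply/ffunP => i; apply/val_inj; have := ab i; rewrite !mnmE.
pose P := \sum_a x a *: 'X_[F, mon a].
have /eqP : P = 0; last first.
  apply/negP; apply: contraNneq x0 => P0; apply/eqP/ffunP => a; rewrite ffunE.
  have : P@_(mon a) = 0 by rewrite P0 mcoeff0.
  rewrite raddf_sum /= (bigD1 a) //= big1 => [|b ba].
    by rewrite mcoeffZ mcoeffX eqxx mulr1 addr0.
  by rewrite mcoeffZ mcoeffX (inj_eq mon_inj) (negPf ba) mulr0.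
apply: indep => y v Zy yv gv.
have /choice[e eH] i : exists e : nat, f i \is e.-homog /\ g i \is e.-homog.
  by case: (frac i).
pose Q := \sum_a x a *: \prod_i (f i ^+ a i * g i ^+ (N - a i)).
have QH : Q \is (\sum_i (e i * N))%N.-homog.
  apply: rpred_sum => a _; apply: rpredZ; apply: dhomog_bigprod => i.
  have [fe ge] := eH i.
  have -> : (e i * N = e i * a i + e i * (N - a i))%N.
    by rewrite -mulnDr subnKC // -ltnS.
  by rewrite dhomogM ?dhomogMn.
have Qv : evalv Q v = 0.
  apply: (phiZ _ _ QH _ y Zy v yv) => t; rewrite -subE.
  have -> : sub Q = 0; last by rewrite meval0.
  rewrite -rel /sub /Q raddf_sum; apply: eq_bigr => a _.
  rewrite /= comp_mpolyZ rmorph_prod; congr (_ *: _); apply: eq_bigr => i _.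
  by rewrite rmorphM !rmorphXn.
apply: (mulfI (_ : \prod_i (evalv (g i) v) ^+ N != 0)).
  by apply/prodf_neq0 => i _; rewrite expf_neq0.
rewrite mulr0 -[RHS]Qv /evalv /P /Q !raddf_sum mulr_sumr; apply: eq_bigr => a _.
rewrite /= !mevalZ mulrCA; congr (_ * _).
rewrite mevalX rmorph_prod -big_split /=; apply: eq_bigr => i _.
rewrite mnmE rmorphM !rmorphXn /= clear_denominator //; last by rewrite -ltnS.
exact: gv.
Qed.

End Projective.

(** * Secant varieties as loci of mixtures *)

Section Mixture.
Variables (F : closedFieldType) (D : moment_family) (d : nat).

(** The equation of the complement of the parameter domain: 1 / lambda must not
    vanish for the inverse Gaussian distribution. *)
Definition admissible_poly (A : comNzRingType) (b : A) : A :=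
  match D with InverseGaussian => b | Gamma => 1 end.

Lemma admissible_chart (t : F * F) :
  param_domain D t <-> admissible_poly (chart D t).2 != 0.
Proof.
rewrite /admissible_poly; case: D => /=; first by rewrite invr_eq0.
by rewrite oner_neq0.
Qed.

Definition mixture_poly (A : comNzRingType) k (c a b : 'I_k -> A) r : A :=
  \sum_i c i * moment_poly D (a i) (b i) r.

Lemma rmorph_mixture_poly (A B : comNzRingType) (f : {rmorphism A -> B}) k
    (c a b : 'I_k -> A) r :
  f (mixture_poly c a b r) = mixture_poly (f \o c) (f \o a) (f \o b) r.
Proof.
rewrite rmorph_sum; apply: eq_bigr => i _.
by rewrite rmorphM rmorph_moment_poly.
Qed.

Lemma mixture_poly0 (A : comNzRingType) k (c a b : 'I_k -> A) :
  mixture_poly c a b 0 = \sum_i c i.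
Proof. by apply: eq_bigr => i _; rewrite moment_poly0 mulr1. Qed.

Definition mixture_point k (c a b : 'I_k -> F) : 'rV[F]_d.+1 :=
  \row_r mixture_poly c a b r.

Lemma mixture_point_sum k (c : 'I_k -> F) (t : 'I_k -> F * F) :
  mixture_point c (fun i => (chart D (t i)).1) (fun i => (chart D (t i)).2)
  = \sum_i c i *: moment_vector D d (t i).
Proof.
apply/rowP => r; rewrite mxE summxE; apply: eq_bigr => i _.
by rewrite !mxE momentE.
Qed.

Lemma mixture_pointZ k s (c a b : 'I_k -> F) :
  mixture_point (fun i => s * c i) a b = s *: mixture_point c a b.
Proof.
apply/rowP => r; rewrite !mxE mulr_sumr; apply: eq_bigr => i _.
by rewrite mulrA.
Qed.

(** The weights are not normalized here: this is the union of the spans of k-tuples of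
    moment points with admissible parameters. *)
Definition mixture_locus k : set (proj_space F d) :=
  [set x | exists c a b : 'I_k -> F,
     (forall i, admissible_poly (b i) != 0) /\ hcoords x (mixture_point c a b)].

Lemma moment_vector_neq0 (t : F * F) : moment_vector D d t != 0.
Proof.
apply/eqP => /rowP/(_ 0)/eqP; rewrite !mxE momentE moment_poly0.
by rewrite oner_eq0.
Qed.

(** Combinations equal to zero have no associated point of projective space; there
    the homogeneity of p is used, with the scalar 0. *)
Lemma vanish_at_mixtures k e (p : {mpoly F[d.+1]}) : (0 < k)%N ->
  p \is e.-homog -> (forall x, mixture_locus k x -> vanishes_at p x) ->
  forall (c : 'I_k -> F) (t : 'I_k -> F * F), (forall i, param_domain D (t i)) ->
    evalv p (\sum_i c i *: moment_vector D d (t i)) = 0.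
Proof.
move=> k0 pe pl c t tD.
have nz (c' : 'I_k -> F) : \sum_i c' i *: moment_vector D d (t i) != 0 ->
    evalv p (\sum_i c' i *: moment_vector D d (t i)) = 0.
  move=> /hcoords_exists[x xc]; apply: (pl x) => //.
  exists c', (fun i => (chart D (t i)).1), (fun i => (chart D (t i)).2).
  by split=> [i|]; [apply/admissible_chart | rewrite mixture_point_sum].
have [c0|] := eqVneq (\sum_i c i *: moment_vector D d (t i)) 0; last exact: nz.
pose i0 := Ordinal k0; pose c1 i : F := (i == i0)%:R.
have c1E : \sum_i c1 i *: moment_vector D d (t i) = moment_vector D d (t i0).
  rewrite (bigD1 i0) //= big1 => [|i /negPf ni]; rewrite /c1 ?ni ?scale0r //.
  by rewrite eqxx scale1r addr0.
rewrite c0 -(scale0r (moment_vector D d (t i0))) (evalvZ _ _ pe) -c1E nz ?mulr0 //.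
by rewrite c1E moment_vector_neq0.
Qed.

Lemma evalv_shift (p : {mpoly F[d.+1]}) (w v : 'rV[F]_d.+1) :
  evalv (p \mPo [tuple 'X_i + (w 0 i)%:MP | i < d.+1]) v = evalv p (v + w).
Proof.
rewrite /evalv comp_mpoly_meval; apply: meval_eq => i.
by rewrite tnth_mktuple mevalD mevalXU mevalC mxE.
Qed.

(** Points of the closure of the moment surface can be replaced by actual moment
    points, one at a time: with the other summands fixed, p is a polynomial in
    the remaining one, and closure_cone applies to it. *)
Lemma Sec_moment_variety k : (0 < k)%N ->
  Sec k (moment_variety F D d) = zariski_closure (mixture_locus k).
Proof.
move=> k0; pose M := [set x | exists2 t : F * F,
               param_domain D t & hcoords x (moment_vector D d t)].
apply/seteqP; split; apply: zariski_closure_sub; try exact: zariski_closureK.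
  move=> x [y My xy] e p pe pl v xv.
  (* The summands of index below j are on lines of the closure, the others are
     multiples of moment vectors. *)
pose ok j (u : 'I_k -> 'rV[F]_d.+1) := forall i : 'I_k, if (i < j)%N
    then exists2 z, zariski_closure M z & u i \in \val z
    else exists t s, param_domain D t /\ u i = s *: moment_vector D d t.
  have key j u : (j <= k)%N -> ok j u -> evalv p (\sum_i u i) = 0.
    elim: j u => [|j IH] u ltj uok.
      have /choice[t tP] i := uok i.
      have /choice[s sP] i : exists s, param_domain D (t i) /\
          u i = s *: moment_vector D d (t i) := tP i.
      rewrite (eq_bigr (fun i => s i *: moment_vector D d (t i))); last first.
        by move=> i _; case: (sP i).
      by apply: (vanish_at_mixtures k0 pe pl) => i; case: (sP i).
    pose j0 := Ordinal ltj.
    have := uok j0; rewrite leqnn => -[z clz uz].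
    rewrite (bigD1 j0) //= -evalv_shift.
    apply: (closure_cone _ clz uz) => z' v' [t tD z't] v'z.
    have [s v'E] := hcoords_scale z't v'z.
    pose u' i := if i == j0 then v' else u i.
    rewrite evalv_shift [X in evalv _ X](_ : _ = \sum_i u' i); last first.
      rewrite [RHS](bigD1 j0) //= /u' eqxx; congr (_ + _).
      by apply: eq_bigr => i /negPf ->.
    apply: IH (ltnW ltj) _ => i; rewrite /u'.
    have [->|ni] := eqVneq i j0; first by rewrite /= ltnn; exists t, s.
    have := uok i; rewrite ltnS leq_eqVlt.
    by rewrite [_ == _ :> nat](negPf ni : (val i == val j0) = false).
  have [u uy vE] := memv_sumP (subvP xy v (hcoords_mem xv)).
  rewrite vE; apply: (key k) => // i; rewrite ltn_ord.
  by exists (y i); [apply: My | apply: uy].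
move=> x [c [a [b [bD xc]]]]; apply: sub_zariski_closure.
pose t i := chart D (a i, b i).
have tK i : chart D (t i) = (a i, b i) by rewrite /t chartK.
have /choice[y yP] i : exists y, hcoords y (moment_vector D d (t i)).
  exact/hcoords_exists/moment_vector_neq0.
exists y => [i|].
  apply: sub_zariski_closure; exists (t i) => //; apply/admissible_chart.
  by rewrite tK; apply: bD.
rewrite /linear_span /= xc -memvE.
have -> : mixture_point c a b = \sum_i c i *: moment_vector D d (t i).
  rewrite -mixture_point_sum; apply/rowP => r; rewrite !mxE.
  by apply: eq_bigr => i _; rewrite tK.
by apply: memv_sumr => i _; rewrite memvZ ?hcoords_mem.
Qed.

End Mixture.

(** * Irreducibility of the secant varieties *)

Section MixtureLocus.
Variables (F : closedFieldType) (D : moment_family) (d : nat).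
Hypothesis char0 : [pchar F] =i pred0.

Definition mixture_segment k (c a b dc da db : 'I_k -> F) (r : nat) : {poly F} :=
  mixture_poly D (fun i => affine_line (c i) (dc i))
    (fun i => affine_line (a i) (da i)) (fun i => affine_line (b i) (db i)) r.

Lemma horner_mixture_segment k (p : {mpoly F[d.+1]}) (c a b dc da db : 'I_k -> F) x :
  (mmap polyC (fun r : 'I_d.+1 => mixture_segment c a b dc da db r) p).[x] =
  evalv p (mixture_point D d (fun i => c i + dc i * x) (fun i => a i + da i * x)
             (fun i => b i + db i * x)).
Proof.
rewrite horner_mmap /evalv; apply: meval_eq => r.
rewrite mxE -horner_evalE [LHS]rmorph_mixture_poly.
by apply: eq_bigr => i _; rewrite /= /horner_eval !horner_affine_line.
Qed.

Definition nonzero_on_mixtures k (p : {mpoly F[d.+1]}) :=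
  exists c a b : 'I_k -> F, (forall i, admissible_poly D (b i) != 0) /\
    evalv p (mixture_point D d c a b) != 0.

(** Two nonempty open sets of parameters meet on the line joining a point of each,
    where all the conditions are nonzero univariate polynomials.  This is the
    irreducibility of the parameter space. *)
Lemma nonzero_on_mixturesM k (p q : {mpoly F[d.+1]}) :
  nonzero_on_mixtures k p -> nonzero_on_mixtures k q -> nonzero_on_mixtures k (p * q).
Proof.
move=> [c1 [a1 [b1 [adm1 p1]]]] [c2 [a2 [b2 [adm2 q2]]]].
pose seg h := mmap polyC (fun r : 'I_d.+1 => mixture_segment c1 a1 b1
   (fun i => c2 i - c1 i) (fun i => a2 i - a1 i) (fun i => b2 i - b1 i) r) h.
pose adm := \prod_i admissible_poly D (affine_line (b1 i) (b2 i - b1 i)).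
have admE x : adm.[x] = \prod_i admissible_poly D (b1 i + (b2 i - b1 i) * x).
  rewrite horner_prod; apply: eq_bigr => i _; rewrite /admissible_poly.
  by case: (D); rewrite ?hornerC // horner_affine_line.
have end0 u v : u + (v - u) * 0 = u :> F by rewrite mulr0 addr0.
have end1 u v : u + (v - u) * 1 = v :> F by rewrite mulr1 addrC subrK.
have p0 : seg p != 0.
  apply: contraNneq p1 => seg0; apply/eqP; have := horner0 (0 : F).
  rewrite -[X in X.[_] = _ -> _]seg0 horner_mixture_segment => h0; rewrite -[RHS]h0.
  by congr (evalv _ (mixture_point _ _ _ _ _)); apply/funext => i; rewrite end0.
have q0 : seg q != 0.
  apply: contraNneq q2 => seg0; apply/eqP; have := horner0 (1 : F).
  rewrite -[X in X.[_] = _ -> _]seg0 horner_mixture_segment => h0; rewrite -[RHS]h0.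
  by congr (evalv _ (mixture_point _ _ _ _ _)); apply/funext => i; rewrite end1.
have adm0 : adm != 0.
  have : adm.[0] != 0.
    by rewrite admE; apply/prodf_neq0 => i _; rewrite end0.
  by apply: contraNneq => ->; rewrite horner0.
have /poly_avoid[x] : adm * (seg p * seg q) != 0 by rewrite !mulf_neq0.
rewrite !hornerM !horner_mixture_segment admE mulf_eq0 negb_or.
move=> /andP[/prodf_neq0 admx pqx].
exists (fun i => c1 i + (c2 i - c1 i) * x), (fun i => a1 i + (a2 i - a1 i) * x),
  (fun i => b1 i + (b2 i - b1 i) * x); split=> [i|]; first exact: admx.
by rewrite /evalv mevalM.
Qed.

(** Multiplying p by a coordinate that is nonzero at x ensures that the common
    nonvanishing point is not the zero vector. *)
Lemma mixture_locus_avoid k (p q : {mpoly F[d.+1]}) x :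
  mixture_locus D k x -> ~ vanishes_at p x -> nonzero_on_mixtures k q ->
  exists y v, [/\ mixture_locus D k y, hcoords y v, evalv p v != 0 & evalv q v != 0].
Proof.
move=> [c [a [b [adm xc]]]] px qnz.
have /existsNP[v /not_implyP[xv /eqP pv]] := px.
have [s vE] := hcoords_scale xc (hcoords_mem xv).
have [r vr] : exists r, v 0 r != 0.
  apply/existsP; apply: contraR (hcoords_neq0 xv) => /existsPn v0.
  by apply/eqP/rowP => r; rewrite mxE; apply/eqP; rewrite -[_ == _]negbK.
have pXnz : nonzero_on_mixtures k (p * 'X_r).
  exists (fun i => s * c i), a, b; split=> //.
  by rewrite mixture_pointZ -vE /evalv mevalM mevalXU mulf_neq0.
have [c' [a' [b' [adm']]]] := nonzero_on_mixturesM pXnz qnz.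
rewrite /evalv !mevalM mevalXU !mulf_eq0 !negb_or -andbA => /and3P[pv' v'r qv'].
have /hcoords_exists[y yv'] : mixture_point D d c' a' b' != 0.
  by apply: contraNneq v'r => ->; rewrite mxE.
by exists y, (mixture_point D d c' a' b'); split=> //; exists c', a', b'.
Qed.

Lemma normalized_mixture_exists k : (0 < k)%N -> exists c a b : 'I_k -> F,
  \sum_i c i = 1 /\ forall i, admissible_poly D (b i) != 0.
Proof.
move=> k0; exists (fun i => (i == Ordinal k0)%:R), (fun=> 1), (fun=> 1); split.
  rewrite (bigD1 (Ordinal k0)) //= ?eqxx big1 ?addr0 // => i /negPf -> //.
by move=> i; rewrite /admissible_poly; case: (D); rewrite oner_neq0.
Qed.

Lemma normalized_mixture_coords k (c a b : 'I_k -> F) :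
  \sum_i c i = 1 -> (forall i, admissible_poly D (b i) != 0) ->
  exists x, [/\ hcoords x (mixture_point D d c a b), mixture_locus D k x
               & mixture_point D d c a b 0 ord0 = 1].
Proof.
move=> sumc adm.
have pt0 : mixture_point D d c a b 0 ord0 = 1 by rewrite mxE mixture_poly0.
have /hcoords_exists[x xc] : mixture_point D d c a b != 0.
  by apply/eqP => z; move/eqP: pt0; rewrite z mxE eq_sym oner_eq0.
by exists x; split=> //; exists c, a, b.
Qed.

Lemma closed_separates (Z : set (proj_space F d)) x : zariski_closed Z -> ~ Z x ->
  exists e p, [/\ p \is e.-homog, forall y, Z y -> vanishes_at p y & ~ vanishes_at p x].
Proof.
move=> Zcl Zx; apply: contrapT => nsep; apply: Zx; rewrite -Zcl => e p pe pZ.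
by apply: contrapT => npx; apply: nsep; exists e, p.
Qed.

Lemma mixture_closure_irreducible k : (0 < k)%N ->
  zariski_irreducible (zariski_closure (@mixture_locus F D d k)).
Proof.
move=> k0; split.
  have [c [a [b [sumc adm]]]] := normalized_mixture_exists k0.
  have [x [_ lx _]] := normalized_mixture_coords a sumc adm.
  by exists x; apply: sub_zariski_closure.
move=> Z1 Z2 cl1 cl2 sub12; apply: contrapT => /not_orP[n1 n2].
have sep Z : zariski_closed Z -> ~ (zariski_closure (@mixture_locus F D d k) `<=` Z) ->
    exists x e p, [/\ mixture_locus D k x, p \is e.-homog,
      forall y, Z y -> vanishes_at p y & ~ vanishes_at p x].
  move=> Zcl nsub; have /existsNP[x /not_implyP[lx Zx]] : ~ (@mixture_locus F D d k `<=` Z).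
    by move=> subZ; apply: nsub; apply: zariski_closure_sub.
  by have [e [p [pe pZ px]]] := closed_separates Zcl Zx; exists x, e, p.
have [x1 [e1 [p1 [l1 h1 v1 nv1]]]] := sep _ cl1 n1.
have [x2 [e2 [p2 [l2 h2 v2 nv2]]]] := sep _ cl2 n2.
have p2nz : nonzero_on_mixtures k p2.
  case: l2 => c [a [b [adm xc]]]; exists c, a, b; split=> //.
  by apply/eqP => p20; apply: nv2; apply/(vanishes_atP h2 xc).
have [y [v [ly yv p1v p2v]]] := mixture_locus_avoid l1 nv1 p2nz.
have [/v1/(_ v yv)|/v2/(_ v yv)] := sub12 y (sub_zariski_closure ly).
  by apply/eqP.
by apply/eqP.
Qed.

(** Every pair (kappa, theta) with nonzero entries comes from an admissible parameter,
    so independence can be read off in the coordinates (kappa, theta). *)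
Lemma mixture_moments_independent n k (P : {mpoly F[n]}) : (n < k * 3)%N ->
  (forall c a b : 'I_k -> F, \sum_i c i = 1 ->
     (forall i, admissible_poly D (b i) != 0) ->
     P.@[fun j => mixture_poly D c a b j.+1] = 0) -> P = 0.
Proof.
move=> ltnk Pvan.
apply: (mixtures_independent (shape_poly0 F D) (shape_wronskian3_neq0 char0 D) char0 ltnk).
move=> c kappa theta sumc reg.
have nz (i : 'I_k) : kappa i != 0 /\ theta i != 0.
  move: reg; rewrite /regular mulf_eq0 negb_or => /andP[_ /prodf_neq0/(_ i isT)].
  by rewrite !mulf_eq0 !negb_or -andbA => /and3P[].
pose t (i : 'I_k) := shape_scale D (kappa i) (theta i).
have := Pvan (fun i => c i) (fun i => (chart D (t i)).1) (fun i => (chart D (t i)).2) sumc.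
have adm i : admissible_poly D (chart D (t i)).2 != 0.
  by apply/admissible_chart/shape_scale_domain; case: (nz i).
move/(_ adm) => P0; rewrite -[RHS]P0; apply: meval_eq => j; apply: eq_bigr => i _.
by rewrite -momentE moment_shape_scale //; case: (nz i).
Qed.

End MixtureLocus.

(** * Dimension of the secant varieties *)

Section Slice.
Variables (F : closedFieldType) (D : moment_family) (d k' : nat).
Let k := k'.+1.
Let n := (k' + (k + k))%N.
Hypothesis char0 : [pchar F] =i pred0.

(** Coordinates on the hyperplane of weights of sum 1: n = 3k - 1 variables, of which
    the first k - 1 are all the weights but the one of index 0. *)
Definition slice_weight (i : 'I_k) : {mpoly F[n]} :=
  if unlift ord0 i is Some j then 'X_(lshift (k + k) j)
  else 1 - \sum_j 'X_(lshift (k + k) j).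
Definition slice_fst (i : 'I_k) : {mpoly F[n]} := 'X_(rshift k' (lshift k i)).
Definition slice_snd (i : 'I_k) : {mpoly F[n]} := 'X_(rshift k' (rshift k i)).
Definition slice_moment (r : nat) : {mpoly F[n]} :=
  mixture_poly D slice_weight slice_fst slice_snd r.

Lemma sum_slice_weight : \sum_i slice_weight i = 1.
Proof.
rewrite big_ord_recl {1}/slice_weight unlift_none.
have -> : \sum_j slice_weight (lift ord0 j) = \sum_j 'X_(lshift (k + k) j).
  by apply: eq_bigr => j _; rewrite /slice_weight liftK.
by rewrite subrK.
Qed.

Lemma slice_moment0 : slice_moment 0 = 1.
Proof. by rewrite /slice_moment mixture_poly0 sum_slice_weight. Qed.

Lemma meval_slice_moment (t : 'I_n -> F) r :
  (slice_moment r).@[t] = mixture_poly D (fun i => (slice_weight i).@[t])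
    (fun i => (slice_fst i).@[t]) (fun i => (slice_snd i).@[t]) r.
Proof. exact: (rmorph_mixture_poly D (meval t)). Qed.

Lemma slice_cover (c a b : 'I_k -> F) : \sum_i c i = 1 ->
  exists t : 'I_n -> F, forall i, [/\ (slice_weight i).@[t] = c i,
     (slice_fst i).@[t] = a i & (slice_snd i).@[t] = b i].
Proof.
move=> sumc.
pose t (l : 'I_n) := match fintype.split l with
  | inl j => c (lift ord0 j)
  | inr l' => match fintype.split l' with inl i => a i | inr i => b i end end.
have tc j : t (lshift (k + k) j) = c (lift ord0 j).
  by rewrite /t -[lshift _ j]/(unsplit (inl j)) unsplitK.
have ta i : t (rshift k' (lshift k i)) = a i.
  rewrite /t -[rshift _ _]/(unsplit (inr (lshift k i))) unsplitK.
  by rewrite -[lshift _ i]/(unsplit (inl i)) unsplitK.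
have tb i : t (rshift k' (rshift k i)) = b i.
  rewrite /t -[rshift k' _]/(unsplit (inr (rshift k i))) unsplitK.
  by rewrite -[rshift _ i]/(unsplit (inr i)) unsplitK.
exists t => i; split; rewrite ?mevalXU ?ta ?tb //.
rewrite /slice_weight; case: unliftP => [j|] ->; first by rewrite mevalXU tc.
have weights : (\sum_j 'X_(lshift (k + k) j)).@[t] = \sum_j c (lift ord0 j).
  by rewrite raddf_sum; apply: eq_bigr => j _; rewrite /= mevalXU tc.
by rewrite mevalB meval1 weights -sumc big_ord_recl addrK.
Qed.

(** Normalized mixtures suffice: by homogeneity they give all mixtures whose weights
    have a nonzero sum, and the others are limits along a line that changes the
    weight of index 0. *)
Lemma slice_dense e (p : {mpoly F[d.+1]}) : p \is e.-homog ->
  (forall t, evalv p (\row_(r < d.+1) (slice_moment r).@[t]) = 0) ->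
  forall x, mixture_locus D k x -> vanishes_at p x.
Proof.
move=> pe p0.
have slice1 (c a b : 'I_k -> F) : \sum_i c i = 1 -> evalv p (mixture_point D d c a b) = 0.
  move=> /(slice_cover a b)[t tE]; rewrite -[RHS](p0 t); congr (evalv p _).
  apply/rowP => r; rewrite !mxE meval_slice_moment; apply: eq_bigr => i _.
  by case: (tE i) => -> -> ->.
have nz (c a b : 'I_k -> F) : \sum_i c i != 0 -> evalv p (mixture_point D d c a b) = 0.
  move=> s0; have cE : c = (fun i => (\sum_i c i) * (c i / \sum_i c i)).
    by apply/funext => i; rewrite mulrC divfK.
  rewrite cE mixture_pointZ (evalvZ _ _ pe) slice1 ?mulr0 //.
  by rewrite -mulr_suml divff.
move=> x [c [a [b [adm xc]]]]; apply/(vanishes_atP pe xc).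
have [s0|] := eqVneq (\sum_i c i) 0; last exact: nz.
pose dc (i : 'I_k) : F := (i == ord0)%:R.
apply: (evalv_line_limit (w := mixture_point D d dc a b)) => s s_nz.
have -> : mixture_point D d c a b + s *: mixture_point D d dc a b =
    mixture_point D d (fun i => c i + s * dc i) a b.
  apply/rowP => r; rewrite !mxE mulr_sumr -big_split; apply: eq_bigr => i _.
  by rewrite mulrDl mulrA.
rewrite nz // big_split /= s0 add0r -mulr_sumr mulf_neq0 //.
rewrite (bigD1 ord0) //= big1 => [|i /negPf]; rewrite /dc ?addr0 ?oner_neq0 //.
by move=> ->.
Qed.

Lemma Sec_trdeg_le (Z : set (proj_space F d)) m :
  Z `<=` zariski_closure (mixture_locus D k) -> trdeg_ge Z m -> (m <= n)%N.
Proof.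
move=> ZX; apply: (trdeg_ge_le (phi := fun r : 'I_d.+1 => slice_moment r)).
move=> e p pe p0 x /ZX clx; apply: (clx e p pe).
exact: slice_dense pe p0.
Qed.

End Slice.

(** The chart x_0 = 1 is a dense affine space of dimension d. *)
Lemma proj_trdeg_le (F : closedFieldType) d (Z : set (proj_space F d)) m :
  trdeg_ge Z m -> (m <= d)%N.
Proof.
pose phi (r : 'I_d.+1) : {mpoly F[d]} := if unlift ord0 r is Some j then 'X_j else 1.
apply: (trdeg_ge_le (phi := phi)) => e p pe p0 x _.
have [v xv] := proj_hcoords x; apply/(vanishes_atP pe xv).
have nz (w : 'rV[F]_d.+1) : w 0 ord0 != 0 -> evalv p w = 0.
  move=> w0; have -> : w = w 0 ord0 *: ((w 0 ord0)^-1 *: w) by rewrite scalerA divff ?scale1r.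
  rewrite (evalvZ _ _ pe) -[X in _ * X](_ : 0 = _) ?mulr0 //.
  rewrite -(p0 (fun j => (w 0 ord0)^-1 * w 0 (lift ord0 j))); congr (evalv p _).
  apply/rowP => r; rewrite !mxE /phi; case: unliftP => [j|] ->.
    by rewrite mevalXU.
  by rewrite meval1 mulVf.
have [v0|] := eqVneq (v 0 ord0) 0; last exact: nz.
apply: (evalv_line_limit (w := \row_r (r == ord0)%:R)) => s s_nz.
by apply: nz; rewrite !mxE v0 add0r eqxx mulr1.
Qed.

Section Dimension.
Variables (F : closedFieldType) (D : moment_family).
Hypothesis char0 : [pchar F] =i pred0.

(** The functions x_j / x_0 restrict to the moments of normalized mixtures. *)
Lemma mixture_trdeg_ge d k N : (0 < k)%N -> (N < k * 3)%N -> (N <= d)%N ->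
  trdeg_ge (zariski_closure (@mixture_locus F D d k)) N.
Proof.
move=> k0 ltN leNd.
exists (fun i : 'I_N => 'X_(lift ord0 (widen_ord leNd i))), (fun=> 'X_ord0); split.
  move=> i; split; first by exists 1%N; rewrite !dhomogX /= !mdeg1.
  have [c [a [b [sumc adm]]]] := normalized_mixture_exists F D k0.
  have [x [xc lx x0]] := normalized_mixture_coords d a sumc adm.
  move=> /(_ x (sub_zariski_closure lx) _ xc); rewrite /evalv mevalXU x0.
  by move/eqP; rewrite oner_eq0.
move=> P Pvan; apply: (mixture_moments_independent (D := D) char0 ltN) => c a b sumc adm.
have [x [xc lx pt0]] := normalized_mixture_coords d a sumc adm.
rewrite -[RHS](Pvan x _ (sub_zariski_closure lx) xc) => [|i].
  by apply: meval_eq => j; rewrite /evalv !mevalXU pt0 divr1 mxE.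
by rewrite /evalv mevalXU pt0 oner_neq0.
Qed.

Theorem mixture_has_dim d k : (0 < k)%N ->
  has_dim (Sec k (moment_variety F D d)) (minn (3 * k - 1) d).
Proof.
move=> k0; rewrite Sec_moment_variety //; split.
  exists (zariski_closure (@mixture_locus F D d k)); split=> //.
  - exact: zariski_closureK.
  - exact: mixture_closure_irreducible.
  - apply: mixture_trdeg_ge; rewrite ?geq_minr //.
    by rewrite (leq_ltn_trans (geq_minl _ _)) // mulnC subn1 prednK // muln_gt0 k0.
move=> Z m ZX _ _ trZ; rewrite leq_min (proj_trdeg_le trZ) andbT.
case: k k0 ZX => // k' _ ZX.
apply: leq_trans (Sec_trdeg_le ZX trZ) _; lia.
Qed.

End Dimension.

(** * Finiteness of generic fibers *)

Section Fibers.
Variables (F : closedFieldType) (D : moment_family) (d k' : nat).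
Let k := k'.+1.
Let n := (k' + (k + k))%N.
Hypothesis char0 : [pchar F] =i pred0.
Hypothesis dE : d = n.

(** There are d + 1 functions Y, M_1, ..., M_d of n = d variables, so they satisfy an
    equation, here written as a polynomial in Y with coefficients H_l in the
    moments, made homogeneous by powers of M_0 = 1.  By independence of the
    moments, a coefficient H_l with a nonzero term does not vanish identically. *)
Lemma slice_function_algebraic (Y : {mpoly F[n]}) :
  exists N (H : 'I_N -> {mpoly F[d.+1]}),
  [/\ exists e, forall l, H l \is e.-homog, exists l, nonzero_on_mixtures D k (H l)
    & forall t : 'I_n -> F,
        \sum_l evalv (H l) (\row_(r < d.+1) (slice_moment F D k' r).@[t]) * Y.@[t] ^+ l = 0].
Proof.
(* The 0-th moment is the constant 1, so Y takes its place. *)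
pose u (i : 'I_d.+1) := if i == ord0 then Y else slice_moment F D k' i.
have ltnd : (n < d.+1)%N by rewrite dE.
have [N [x x0 rel]] := algebraic_dependence u (fun=> 1) ltnd.
pose A := {ffun 'I_d.+1 -> 'I_N.+1}.
pose term (a : A) : {mpoly F[d.+1]} :=
  \prod_(j < d) ('X_(lift ord0 j) ^+ a (lift ord0 j) * 'X_ord0 ^+ (N - a (lift ord0 j))).
pose H (l : 'I_N.+1) := \sum_(a : A | a ord0 == l) x a *: term a.
exists N.+1, H; split.
- exists (\sum_(j < d) N)%N => l; apply: rpred_sum => a _; apply: rpredZ.
  apply: dhomog_bigprod => j; set e := a _.
  have NE : (N = 1 * e + 1 * (N - e))%N by rewrite !mul1n subnKC // -ltnS.
  rewrite [X in _ \is X.-homog]NE.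
  by rewrite dhomogM ?dhomogMn // dhomogX /= mdeg1.
- have [a0 xa0] : exists a0, x a0 != 0.
    apply/existsP; apply: contraR x0 => /existsPn x0.
    by apply/eqP/ffunP => a; rewrite ffunE; apply/eqP; rewrite -[_ == _]negbK.
  exists (a0 ord0).
  pose mon (a : A) : 'X_{1..d} := [multinom (a (lift ord0 j) : nat) | j < d].
  pose L := \sum_(a : A | a ord0 == a0 ord0) x a *: 'X_[F, mon a].
  have L0 : L != 0.
    apply: contraNneq xa0 => L0; have : L@_(mon a0) = 0 by rewrite L0 mcoeff0.
    rewrite raddf_sum /= (bigD1 a0) //= big1 => [|a /andP[/eqP aa0 na]].
      by rewrite mcoeffZ mcoeffX eqxx mulr1 addr0 => ->.
    rewrite mcoeffZ mcoeffX [mon a == mon a0](_ : _ = false) ?mulr0 //.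
    apply: contraNF na => /eqP/mnmP mon_a; apply/eqP/ffunP => i.
    case: (unliftP ord0 i) => [j|] -> //.
    by apply/val_inj; have := mon_a j; rewrite !mnmE.
  apply: contrapT => nnz; move/eqP: L0; apply.
  apply: (mixture_moments_independent (D := D) (k := k) char0).
    by rewrite dE /n /k; lia.
  move=> c a b sumc adm; apply: contrapT => /eqP Lnz; apply: nnz.
  exists c, a, b; split=> //; apply: contraNneq Lnz => HL; apply/eqP.
  rewrite -[RHS]HL /L /H /evalv !raddf_sum; apply: eq_bigr => m _.
  rewrite /= !mevalZ; congr (_ * _); rewrite mevalX rmorph_prod; apply: eq_bigr => j _.
  rewrite rmorphM !rmorphXn /= !mevalXU !mxE mixture_poly0 sumc expr1n mulr1.
  by rewrite mnmE.
- move=> t; rewrite -[RHS](meval0 t) -rel raddf_sum.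
  rewrite (partition_big (fun a : A => a ord0) predT) //=.
  apply: eq_bigr => l _; rewrite /evalv raddf_sum mulr_suml.
  apply: eq_bigr => a /eqP al; rewrite /= !mevalZ -mulrA; congr (_ * _).
  rewrite !rmorph_prod big_ord_recl /= /u eqxx !expr1n mulr1 rmorphXn al mulrC.
  congr (_ * _); apply: eq_bigr => j _.
  rewrite rmorphM !rmorphXn /= !mevalXU !mxE expr1n mulr1 rmorphXn.
  by rewrite [slice_moment _ _ _ ord0]slice_moment0 meval1 expr1n mulr1.
Qed.

(** Where the coefficient H_l is nonzero, Y is a root of a nonzero polynomial that
    depends only on x: normalized mixtures over x share one moment vector, whose
    entry of index 0 is 1. *)
Lemma slice_function_finite (Y : {mpoly F[n]}) : exists H : {mpoly F[d.+1]},
  [/\ exists e, H \is e.-homog, nonzero_on_mixtures D k H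
    & forall x, ~ vanishes_at H x -> exists s : seq F, forall t : 'I_n -> F,
        hcoords x (\row_(r < d.+1) (slice_moment F D k' r).@[t]) -> Y.@[t] \in s].
Proof.
have [N [H [[e He] [l Hl] rel]]] := slice_function_algebraic Y.
exists (H l); split=> // [|x Hx]; first by exists e.
pose v t := \row_(r < d.+1) (slice_moment F D k' r).@[t].
have [[t0 xt0]|none] := pselect (exists t, hcoords x (v t)); last first.
  by exists [::] => t xt; case: none; exists t.
have v0 t : v t 0 ord0 = 1.
  by rewrite mxE [slice_moment _ _ _ ord0]slice_moment0 meval1.
have vE t : hcoords x (v t) -> v t = v t0.
  move=> xt; have [s st] := hcoords_scale xt0 (hcoords_mem xt).
  by have := v0 t; rewrite st mxE v0 mulr1 => ->; rewrite scale1r.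
pose g := \poly_(i < N) oapp (fun l => evalv (H l) (v t0)) 0 (insub i).
have gE (i : 'I_N) : g`_i = evalv (H i) (v t0) by rewrite coef_poly ltn_ord valK.
have /finite_roots[s sP] : g != 0.
  apply: contra_not_neq Hx => g0; apply/(vanishes_atP (He l) xt0).
  by rewrite -gE g0 coef0.
exists s => t /vE vt; apply: sP; rewrite /root horner_poly -[X in _ == X](rel t).
by apply/eqP/eq_bigr => i _; rewrite valK /= -/(v t) vt.
Qed.

Lemma finite_fiber_bounded (s : seq F) (x : proj_space F d) :
  (forall q, mixture_fiber D x q -> forall i : 'I_k,
     [/\ q.2 i \in s, (chart D (q.1 i)).1 \in s & (chart D (q.1 i)).2 \in s]) ->
  finite_set (@mixture_fiber F D k d x).
Proof.
move=> fs.
pose T := ({ffun 'I_k -> seq_sub s * seq_sub s} * {ffun 'I_k -> seq_sub s})%type.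
pose dec (z : T) : mixture_params F k :=
  ([ffun i => chart D (ssval (z.1 i).1, ssval (z.1 i).2)], [ffun i => ssval (z.2 i)]).
apply: (sub_finite_set (B := dec @` [set: T])); last exact/finite_image/finite_finset.
move=> q /fs qs.
have s2 i : q.2 i \in s by case: (qs i).
have s11 i : (chart D (q.1 i)).1 \in s by case: (qs i).
have s12 i : (chart D (q.1 i)).2 \in s by case: (qs i).
exists ([ffun i => (SeqSub (s11 i), SeqSub (s12 i))], [ffun i => SeqSub (s2 i)]) => //.
rewrite /dec; case: q {fs qs s2 s11 s12} (s2) (s11) (s12) => q1 q2 /= s2 s11 s12.
congr (_, _); apply/ffunP => i; rewrite !ffunE //=.
by rewrite -surjective_pairing chartK.
Qed.

Lemma generic_fiber_finite : exists H,
  [/\ exists e, H \is e.-homog, nonzero_on_mixtures D k H &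
   forall x : proj_space F d, ~ vanishes_at H x -> finite_set (@mixture_fiber F D k d x)].
Proof.
pose Y (j : 'I_k * 'I_3) : {mpoly F[n]} :=
  match val j.2 with 0 => slice_weight F j.1 | 1 => slice_fst F j.1 | _ => slice_snd F j.1 end.
have /choice[H HP] j := slice_function_finite (Y j).
exists (\prod_j H j); split.
- have /choice[e He] j : exists e, H j \is e.-homog by case: (HP j).
  by exists (\sum_j e j)%N; apply: dhomog_bigprod.
- apply: (big_ind (nonzero_on_mixtures D k)) => [|p q|j _]; last by case: (HP j).
    have [c [a [b [_ adm]]]] := normalized_mixture_exists F D (ltn0Sn k').
    by exists c, a, b; split=> //; rewrite /evalv meval1 oner_neq0.
  exact: nonzero_on_mixturesM.
move=> x Hx.
have Hjx j : ~ vanishes_at (H j) x.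
  move=> Hj; apply: Hx => v /Hj Hjv.
  by rewrite /evalv rmorph_prod (bigD1 j) //= -/(evalv _ _) Hjv mul0r.
have /choice[s sP] j : exists s : seq F, forall t : 'I_n -> F,
    hcoords x (\row_(r < d.+1) (slice_moment F D k' r).@[t]) -> (Y j).@[t] \in s.
  by case: (HP j) => _ _; apply.
apply: (@finite_fiber_bounded (flatten [seq s j | j <- enum {: 'I_k * 'I_3}])).
move=> q [[qD sumq] xq] i.
have [t tE] := slice_cover (fun i => (chart D (q.1 i)).1) (fun i => (chart D (q.1 i)).2) sumq.
have xt : hcoords x (\row_(r < d.+1) (slice_moment F D k' r).@[t]).
  rewrite [X in hcoords _ X](_ : _ = mixture_moment_vector D d q) //.
  apply/rowP => r; rewrite !mxE meval_slice_moment; apply: eq_bigr => l _.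
  by case: (tE l) => -> -> ->; rewrite momentE.
have sub j : (Y j).@[t] \in flatten [seq s j | j <- enum {: 'I_k * 'I_3}].
  by apply/flattenP; exists (s j); [apply: map_f; rewrite mem_enum | apply: sP].
have [<- <- <-] := tE i.
by split; [apply: (sub (i, 0)) | apply: (sub (i, 1)) | apply: (sub (i, @Ordinal 3 2 isT))].
Qed.

End Fibers.

(** The generic open set is the complement of the product H of the conditions for all
    the parameters; it is dense because the secant variety is irreducible. *)
Theorem mixtures_identifiable (F : closedFieldType) (D : moment_family) k :
  [pchar F] =i pred0 -> (0 < k)%N -> algebraically_identifiable F D k (3 * k - 1).
Proof.
move=> char0; case: k => // k' _.
rewrite /algebraically_identifiable /= Sec_moment_variety //.
have dE : (3 * k'.+1 - 1 = k' + (k'.+1 + k'.+1))%N by lia.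
have [H [[e He] Hnz finH]] := generic_fiber_finite D char0 dE.
set X := zariski_closure _.
exists (X `\` [set x | vanishes_at H x]); split.
- by exists [set x | vanishes_at H x] => //; apply: zeros_closed He.
- apply: zariski_closure_sub; first exact: zariski_closureK.
  move=> x lx e' p pe pU; apply: contrapT => px.
  have [y [v [ly yv pv Hv]]] := mixture_locus_avoid lx px Hnz.
  move/eqP: pv; apply; apply: (pU y) => //; split; first exact: sub_zariski_closure.
  by move=> /(_ v yv); apply/eqP.
- by move=> x [_ Hx]; apply: finH.
Qed.

Theorem theorem1p1 (R : realType) (D : moment_family) :
  (forall d k : nat, (2 <= d)%N -> (2 <= k)%N ->
     has_dim (Sec k (moment_variety R[i] D d)) (minn (3 * k - 1) d)) /\
  (forall k : nat, (2 <= k)%N ->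
     algebraically_identifiable R[i] D k (3 * k - 1)).
Proof.
have char0 : [pchar R[i]] =i pred0 := Num.Theory.pchar_num _.
split=> [d k _ k2|k k2]; first by apply: mixture_has_dim; rewrite // ltnW.
by apply: mixtures_identifiable; rewrite // ltnW.
Qed.
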